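(* Let $\mathcal{H}=\mathcal{H}(\Omega)$ be a reproducing kernel Hilbert space, let $\sigma$ be a symmetric mean with interpolation path $\sigma_t$, $t\in[0,1]$. Let $A,B\in B(\mathcal{H})$, where $A$ has polar decomposition $A=\mathcal{U}|A|$, and let $f,g:[0,\infty)\to[0,\infty)$ be nonnegative continuous functions. Let $r,s>1$ be conjugate exponents satisfying $\frac1r+\frac1s=1$. If $\sigma_t\le\nabla_t$, then for $p\ge2$ $$\left\|g(|B|)f(|A^*|)\mathcal{U}\right\|^p_{ber_{\sigma_t}}\le\mathrm{ber}\left(\tfrac{t}{r}f^{pr}(|A|)+\tfrac{1-t}{s}g^{ps}(|B|)\right)+\mathrm{ber}\left(\tfrac{t}{s}g^{ps}(|B|)+\tfrac{1-t}{r}f^{pr}(|A|)\right).$$ In particular, if $f$ and $g$ are nonnegative continuous functions on $[0,\infty)$ such that $f(x)g(x)=x$ for all $x\ge 0$, then $$\|A\|^p_{ber_{\sigma_t}}\le\mathrm{ber}\left(\tfrac{t}{r}f^{pr}(|A|)+\tfrac{1-t}{s}g^{ps}(|A^*|)\right)+\mathrm{ber}\left(\tfrac{t}{s}g^{ps}(|A^*|)+\tfrac{1-t}{r}f^{pr}(|A|)\right).$$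
   Context: A reproducing kernel Hilbert space $\mathcal{H}=\mathcal{H}(\Omega)$ on a nonempty set $\Omega$ is a Hilbert space of complex-valued functions on $\Omega$ whose point evaluations are bounded; $k_\lambda\in\mathcal H$ is the reproducing kernel at $\lambda\in\Omega$ (so $f(\lambda)=\langle f,k_\lambda\rangle$ for all $f\in\mathcal H$), and $\hat k_\lambda=k_\lambda/\|k_\lambda\|$ is the normalized reproducing kernel (implicitly $k_\lambda\ne 0$ for all $\lambda$). $B(\mathcal H)$ is the algebra of bounded linear operators on $\mathcal H$; $|A|=(A^*A)^{1/2}$; the polar decomposition $A=\mathcal U|A|$ has $\mathcal U$ a partial isometry; $f(|A|)$ is defined by the continuous functional calculus and $f^q(|A|)=(f(|A|))^q$. A mean is a function $\sigma:[0,\infty)\times[0,\infty)\to[0,\infty)$, written $a\,\sigma\, b=\sigma(a,b)$, such that: $\sigma(a,b)\ge 0$; $a\le b$ implies $a\le a\,\sigma\, b\le b$; $\sigma$ is increasing in both variables; $\sigma(\alpha a,\alpha b)=\alpha\,\sigma(a,b)$ for $\alpha>0$; $\sigma$ is continuous. It is symmetric if $a\,\sigma\, b=b\,\sigma\, a$ for all $a,b$. An interpolation path for a symmetric mean $\sigma$ is a family of means $\sigma_t$, $t\in[0,1]$, such that: (i) $a\,\sigma_0\, b=b$, $a\,\sigma_1\, b=a$, $a\,\sigma_{1/2}\, b=a\,\sigma\, b$ for all $a,b\ge0$; (ii) $(a\,\sigma_t\, b)\,\sigma\,(a\,\sigma_u\, b)=a\,\sigma_{(t+u)/2}\, b$ for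 all $t,u\in[0,1]$; (iii) each $\sigma_t$ is increasing in each component. The arithmetic mean $a\nabla b=(a+b)/2$ has interpolation path $a\nabla_t b=ta+(1-t)b$; $\sigma_t\le\nabla_t$ means $a\,\sigma_t\,b\le ta+(1-t)b$ for all $a,b\ge0$. For $A\in B(\mathcal H)$, $t\in[0,1]$ and $p\ge1$, the $\sigma_t$-Berezin norm is $\|A\|_{ber_{\sigma_t}}=\sup_{\lambda,\mu\in\Omega}\left(|\langle A\hat k_\lambda,\hat k_\mu\rangle|^p\,\sigma_t\,|\langle A^*\hat k_\lambda,\hat k_\mu\rangle|^p\right)^{1/p}$ (the $p$ here is the $p$ of the claim). The Berezin radius is $\mathrm{ber}(A)=\sup_{\lambda\in\Omega}|\langle A\hat k_\lambda,\hat k_\lambda\rangle|$. *)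

(* Defs.v *)
From HB Require Import structures.
From mathcomp Require Import all_boot all_order all_algebra.
From mathcomp Require Import sesquilinear complex.
From mathcomp Require Import boolp classical_sets functions reals.
From mathcomp Require Import topology normedtype exp.

Set Implicit Arguments.
Unset Strict Implicit.
Unset Printing Implicit Defensive.

Import Order.TTheory GRing.Theory Num.Theory.
Import numFieldNormedType.Exports.

Local Open Scope classical_set_scope.
Local Open Scope ring_scope.
Local Open Scope complex_scope.

Definition cmod (R : realType) (z : R[i]) : R := ComplexField.Normc.normc z.

(* A Hilbert space of complex-valued functions on [Omega].  The elements are
   identified with functions by the injective linear map [eval], so that the
   vector space operations are the pointwise ones.  As in [{dot _ for _}], the
   inner product is linear in its first argument.  The norm takes its values in
   [R[i]], where it is real and nonnegative. *)
Record rkhs (R : realType) (Omega : Type) := RKHS {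
  rkhs_space :> completeNormedModType R[i];
  inner : {dot rkhs_space for Num.conj};
  sqr_norm_inner : forall f : rkhs_space, `|f| ^+ 2 = inner f f;
  eval : rkhs_space -> Omega -> R[i];
  evalP : forall (a : R[i]) (f g : rkhs_space) (w : Omega),
    eval (a *: f + g) w = a * eval f w + eval g w;
  eval_inj : injective eval;
  eval_bounded : forall w : Omega, exists M : R[i],
    forall f : rkhs_space, `|eval f w| <= M * `|f|
}.

Section Operators.
Variables (R : realType) (Omega : Type) (H : rkhs R Omega).
Implicit Types (A S T U : H -> H).

Definition bounded_operator A : Prop :=
  (forall (a : R[i]) (x y : H), A (a *: x + y) = a *: A x + A y) /\
  (exists M : R[i], forall x : H, `|A x| <= M * `|x|).

(* Below, [get P] is the element satisfying [P]; it exists and is unique by the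
   Riesz representation theorem in [rkernel] and [adjoint], and in [cfc] for
   self-adjoint [T] and [f] continuous on the spectrum of [T]. *)

Definition rkernel (w : Omega) : H :=
  get [set k : H | forall f : H, eval f w = inner H f k].

Definition nkernel (w : Omega) : H := `|rkernel w|^-1 *: rkernel w.

Definition adjoint A : H -> H :=
  get [set S : H -> H | bounded_operator S /\
    forall x y : H, inner H (A x) y = inner H x (S y)].

Definition spectrum T : set R[i] :=
  [set z | ~ exists S : H -> H, bounded_operator S /\
    (forall x : H, S (T x - z *: x) = x) /\
    (forall x : H, T (S x) - z *: S x = x)].

Definition poly_op (p : {poly R}) T : H -> H :=
  fun x => \sum_(i < size p) (p`_i)%:C *: iter i T x.

(* Continuous functional calculus of a self-adjoint operator [T], applied to a
   real function [f]: [cfc f T] is the norm limit of [p T] as the real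
   polynomial [p] tends to [f] uniformly on the (real) spectrum of [T]. *)
Definition cfc (f : R -> R) T : H -> H :=
  get [set S : H -> H | bounded_operator S /\
    forall e : R, 0 < e -> exists p : {poly R},
      (forall x : R, spectrum T x%:C -> `|p.[x] - f x| <= e) /\
      (forall v : H, `|poly_op p T v - S v| <= e%:C * `|v|)].

Definition abs_op A : H -> H := cfc Num.sqrt (adjoint A \o A).

Definition pow_op (q : R) T : H -> H := cfc (fun x => x `^ q) T.

(* Isometric on the orthogonal complement of its kernel. *)
Definition partial_isometry U : Prop :=
  bounded_operator U /\
  forall x : H, (forall y : H, U y = 0 -> inner H x y = 0) -> `|U x| = `|x|.

Definition polar_decomposition A U : Prop :=
  partial_isometry U /\ A = U \o abs_op A.

(* The suprema below are over bounded sets when [A] is a bounded operator and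
   [m] is a mean, since then m(a, b) <= m(c, c) = c for 0 <= a, b <= c. *)

Definition ber A : R :=
  sup [set cmod (inner H (A (nkernel w)) (nkernel w)) | w in [set: Omega]].

Definition ber_norm (m : R -> R -> R) (p : R) A : R :=
  sup [set (m (cmod (inner H (A (nkernel u.1)) (nkernel u.2)) `^ p)
              (cmod (inner H (adjoint A (nkernel u.1)) (nkernel u.2)) `^ p))
           `^ p^-1 | u in [set: Omega * Omega]].

End Operators.

(* Means are functions on [0, +oo[ x [0, +oo[; values elsewhere are irrelevant. *)

Definition increasing2 (R : realType) (m : R -> R -> R) : Prop :=
  forall a a' b b' : R, 0 <= a -> a <= a' -> 0 <= b -> b <= b' ->
    m a b <= m a' b'.

Record is_mean (R : realType) (m : R -> R -> R) : Prop := IsMean {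
  mean_ge0 : forall a b : R, 0 <= a -> 0 <= b -> 0 <= m a b;
  mean_between : forall a b : R, 0 <= a -> a <= b -> a <= m a b /\ m a b <= b;
  mean_increasing : increasing2 m;
  mean_homogeneous : forall alpha a b : R, 0 < alpha -> 0 <= a -> 0 <= b ->
    m (alpha * a) (alpha * b) = alpha * m a b;
  mean_continuous : {within [set x : R * R | 0 <= x.1 /\ 0 <= x.2],
    continuous (fun x : R * R => m x.1 x.2)}
}.

Definition symmetric_mean (R : realType) (m : R -> R -> R) : Prop :=
  is_mean m /\ forall a b : R, 0 <= a -> 0 <= b -> m a b = m b a.

Record interpolation_path (R : realType) (sigma : R -> R -> R)
    (sigma_ : R -> R -> R -> R) : Prop := InterpolationPath {
  path_mean : forall t : R, 0 <= t <= 1 -> is_mean (sigma_ t);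
  path0 : forall a b : R, 0 <= a -> 0 <= b -> sigma_ 0 a b = b;
  path1 : forall a b : R, 0 <= a -> 0 <= b -> sigma_ 1 a b = a;
  path_half : forall a b : R, 0 <= a -> 0 <= b -> sigma_ 2^-1 a b = sigma a b;
  path_mid : forall t u a b : R, 0 <= t <= 1 -> 0 <= u <= 1 ->
    0 <= a -> 0 <= b ->
    sigma (sigma_ t a b) (sigma_ u a b) = sigma_ ((t + u) / 2) a b;
  path_increasing : forall t : R, 0 <= t <= 1 -> increasing2 (sigma_ t)
}.

(* Main.v *)
Require Import Defs.
From HB Require Import structures.
From mathcomp Require Import all_boot all_order all_algebra.
From mathcomp Require Import sesquilinear complex.
From mathcomp Require Import boolp classical_sets functions reals.
From mathcomp Require Import topology normedtype exp derive realfun.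
From mathcomp Require Import ring lra.

Set Implicit Arguments.
Unset Strict Implicit.
Unset Printing Implicit Defensive.

Import Order.TTheory GRing.Theory Num.Theory.
Import numFieldNormedType.Exports.

Local Open Scope classical_set_scope.
Local Open Scope ring_scope.
Local Open Scope complex_scope.

(** The operator [X = g(|B|) f(|A*|) U] equals [g(|B|) U f(|A|)].  Indeed
    [U* U |A| = |A|], hence [(A A* ) U = U (A* A)]; polynomials, and therefore
    continuous functions, of [A A*] and [A* A] are intertwined by [U] in the same
    way, and both [|A*|], [|A|] and their images under [f] are obtained like this
    ([cfc_intertwine], [abs_op_polar]).  As [U] is a contraction, Cauchy-Schwarz
    gives, for unit vectors [u] and [w],
    [|<X u, w>| <= ||f(|A|) u|| ||g(|B|) w||]; Young's inequality with exponents
    [r, s] and the McCarthy inequality [||S v||^q <= <S^q v, v>] ([mccarthy]),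
    applied with [q = p r] and [q = p s], turn this into
    [|<X u, w>|^p <= r^-1 <f(|A|)^(p r) u, u> + s^-1 <g(|B|)^(p s) w, w>].
    The entries of [X*] are those of [X] with [u] and [w] exchanged.  Since the
    mean lies below the weighted arithmetic mean, the quantity under the supremum
    is at most a form value at [u] plus a form value at [w], each bounded by a
    Berezin radius ([ber_norm_young]).  If [f(x) g(x) = x] and [B = A*], then
    [X = |A*| U = U |A| = A], so the second inequality is an instance of the first.

    The operators above are only specified by a choice operator, so the bulk of
    the work is to show that the specified objects exist and behave as expected.
    Three existence results (Riesz representation, orthogonal projection and
    inversion of a coercive self-adjoint operator) come from a single
    minimisation of a quadratic functional on a closed subspace
    ([form_riesz]).  The functional calculus rests on two facts.  A polynomial
    [q] bounded by [e] on the real spectrum of a self-adjoint [T] satisfies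
    [||q(T)|| <= e] ([spectral_bound]): if [N = ||q(T)|| > e], then
    [q(T)^2 - N^2] is not bounded below, whereas it is a product of factors
    [T - z] in which no root [z] of [q^2 - N^2] lies in the spectrum, so every
    factor is bounded below.  And polynomials are uniformly dense among the
    continuous functions on a segment ([weierstrass]). *)

(** * Uniform approximation by polynomials on a segment *)

Section Weierstrass.
Variable R : realType.

Lemma invn_small (e : R) : 0 < e ->
  exists N : nat, forall n, (N <= n)%N -> n.+1%:R^-1 <= e.
Proof.
move=> e0; exists (Num.truncn e^-1) => n hn.
rewrite invf_ple ?posrE//; apply/ltW/(lt_le_trans (truncnS_gt _)).
by rewrite ler_nat.
Qed.

Lemma mul_dist_le (F G d x y x' y' : R) : 0 <= d <= 1 ->
  `|x| <= F -> `|y| <= G -> `|x' - x| <= d -> `|y' - y| <= d ->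
  `|x' * y' - x * y| <= d * (F + G + 1).
Proof.
move=> /andP[d0 d1] xF yG hx hy.
have -> : x' * y' - x * y = (x' - x) * (y' - y) + x * (y' - y) + (x' - x) * y by ring.
have := ler_normD ((x' - x) * (y' - y) + x * (y' - y)) ((x' - x) * y).
have := ler_normD ((x' - x) * (y' - y)) (x * (y' - y)).
rewrite !normrM.
have h1 : `|x' - x| * `|y' - y| <= d * 1 by rewrite ler_pM//; lra.
have h2 : `|x| * `|y' - y| <= F * d by rewrite ler_pM.
have h3 : `|x' - x| * `|y| <= d * G by rewrite ler_pM.
by nra.
Qed.

(** The graph of [u |-> u^(q/2)] lies above its tangent at [y^2]; take [u = x^2].
    After scaling to [y = 1] this is Bernoulli's inequality, itself Young's
    inequality for the pair [u, 1] with exponent [q / 2].  The quadratic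
    minorant is what makes the McCarthy inequality a statement about
    polynomials of degree two. *)
Lemma powR_tangent (q x y : R) : 2 < q -> 0 <= x -> 0 < y ->
  y `^ q + q / 2 * y `^ (q - 2) * (x ^+ 2 - y ^+ 2) <= x `^ q.
Proof.
move=> q2 x0 y0.
have yq : y `^ q = y `^ (q - 2) * y ^+ 2.
  rewrite -powR_mulrn ?(ltW y0)// -powRD ?subrK//.
  by rewrite (gt_eqF y0) implybT.
set c := y `^ (q - 2) in yq *.
have c0 : 0 < c by apply: powR_gt0.
set u := x ^+ 2 / y ^+ 2.
have u0 : 0 <= u by rewrite divr_ge0// sqr_ge0.
have a0 : 0 < q / 2 by lra.
have uq : u `^ (q / 2) * y `^ q = x `^ q.
  have -> : y `^ q = (y ^+ 2) `^ (q / 2).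
    by rewrite -powR_mulrn ?(ltW y0)// -powRrM; congr (_ `^ _); field.
  rewrite -powRM ?sqr_ge0// divfK ?sqrf_eq0 ?gt_eqF//.
  by rewrite -powR_mulrn// -powRrM; congr (_ `^ _); field.
have hb : 0 < 1 - (q / 2)^-1 by rewrite subr_gt0 invf_lt1//; lra.
have := @conjugate_powR R u 1 (q / 2) (1 - (q / 2)^-1)^-1 u0 ler01 a0.
rewrite invr_gt0 invrK powR1 mulr1 mul1r => /(_ hb) h.
have {}h : u <= u `^ (q / 2) / (q / 2) + (1 - (q / 2)^-1) by apply: h; ring.
have h2 : q / 2 * u <= u `^ (q / 2) + q / 2 - 1.
  move: h; rewrite -(ler_pM2l a0) => /le_trans; apply.
  by rewrite le_eqVlt; apply/orP; left; apply/eqP; field; apply/eqP; lra.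
have yy : 0 < y ^+ 2 by rewrite exprn_gt0.
have xu : x ^+ 2 = u * y ^+ 2 by rewrite divfK// gt_eqF.
rewrite -uq yq xu.
have : 0 <= c * y ^+ 2 * (u `^ (q / 2) + q / 2 - 1 - q / 2 * u).
  by apply: mulr_ge0; [apply: mulr_ge0; exact: ltW | lra].
by nra.
Qed.

(** The expected value of [f] after [n] steps of a random walk started at [x],
    each step being [h] with probability ['X] and [0] otherwise; for [x = 0] and
    [h = 1 / n] it is the Bernstein polynomial of [f].  The recursion makes
    linearity, positivity and the variance immediate, without binomial sums. *)
Fixpoint bernstein (h : R) (n : nat) (x : R) (f : R -> R) : {poly R} :=
  if n is n'.+1
  then 'X * bernstein h n' (x + h) f + (1 - 'X) * bernstein h n' x f
  else (f x)%:P.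

Lemma bernstein_rec h n x f y : (bernstein h n.+1 x f).[y] =
  y * (bernstein h n (x + h) f).[y] + (1 - y) * (bernstein h n x f).[y].
Proof. by rewrite /= !hornerE. Qed.

Lemma bernstein_lin h n x f (a b c : R) u y :
  (bernstein h n x (fun z => a * f z + b * u z + c)).[y] =
  a * (bernstein h n x f).[y] + b * (bernstein h n x u).[y] + c.
Proof.
elim: n x => [|n IH] x; first by rewrite /= !hornerE.
by rewrite !bernstein_rec !IH; ring.
Qed.

Lemma bernstein_ge0 h n x f y : 0 <= h -> 0 <= y <= 1 ->
  (forall z, x <= z <= x + n%:R * h -> 0 <= f z) ->
  0 <= (bernstein h n x f).[y].
Proof.
move=> h0 /andP[y0 y1]; elim: n x => [|n IH] x hx.
  by rewrite /= hornerE; apply: hx; rewrite mul0r addr0 lexx.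
have nh : 0 <= n%:R * h by rewrite mulr_ge0.
rewrite bernstein_rec addr_ge0// mulr_ge0 ?subr_ge0//; apply: IH => z /andP[z0 z1].
  by apply: hx; rewrite -natr1 mulrDl mul1r; apply/andP; split; lra.
by apply: hx; rewrite -natr1 mulrDl mul1r; apply/andP; split; lra.
Qed.

(** Second moment around [c]: squared bias plus the variance of [n] steps. *)
Lemma bernstein_var h n x c y :
  (bernstein h n x (fun z => (z - c) ^+ 2)).[y] =
  (x + n%:R * h * y - c) ^+ 2 + n%:R * h ^+ 2 * (y * (1 - y)).
Proof.
elim: n x => [|n IH] x; first by rewrite /= hornerE; ring.
by rewrite bernstein_rec !IH -natr1; ring.
Qed.

Definition uniformly_continuous_on (a b : R) (f : R -> R) :=
  forall e : R, 0 < e -> exists2 d : R, 0 < d &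
    forall x y, a <= x <= b -> a <= y <= b -> `|x - y| < d ->
      `|f x - f y| <= e.

(** Chebyshev's argument: near [y] uniform continuity controls [f z - f y], and
    far from [y] it is at most [K * (z - y)^2]; the expectation of the square is
    the variance, of order [1 / n]. *)
Lemma weierstrass01 (f : R -> R) (M : R) :
  (forall x, 0 <= x <= 1 -> `|f x| <= M) -> uniformly_continuous_on 0 1 f ->
  forall e : R, 0 < e -> exists p : {poly R},
    forall x, 0 <= x <= 1 -> `|p.[x] - f x| <= e.
Proof.
move=> fM fu e e0.
have [d d0 hd] := fu (e / 2) (divr_gt0 e0 (ltr0Sn _ _)).
have M0 : 0 <= M by apply: le_trans (fM 0 _); rewrite ?lexx ?ler01.
set K := 2 * M / d ^+ 2.
have K0 : 0 <= K by rewrite divr_ge0 ?sqr_ge0 ?mulr_ge0.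
have [n hn] : exists n : nat, K / (e / 2) <= n.+1%:R.
  exists (Num.truncn (K / (e / 2))); apply/ltW.
  exact: truncnS_gt.
set h : R := n.+1%:R^-1.
have h0 : 0 < h by rewrite invr_gt0.
have nh : n.+1%:R * h = 1 by rewrite /h mulfV ?pnatr_eq0.
exists (bernstein h n.+1 0 f) => y hy.
have dom z : 0 <= z <= 1 -> `|f z - f y| <= e / 2 + K * (z - y) ^+ 2.
  move=> hz; have [zy|zy] := ltP `|z - y| d.
    by apply: (le_trans (hd _ _ hz hy zy)); rewrite lerDl; apply: mulr_ge0; rewrite ?sqr_ge0.
  have dd : d ^+ 2 <= (z - y) ^+ 2.
    by rewrite -[leRHS]real_normK ?num_real// lerXn2r// ?nnegrE ?(ltW d0).
  have : 2 * M <= K * (z - y) ^+ 2.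
    by rewrite /K -mulrAC ler_pdivlMr ?exprn_gt0// ler_wpM2l// mulr_ge0.
  have := ler_normB (f z) (f y); have := fM _ hz; have := fM _ hy; lra.
have var : (bernstein h n.+1 0 (fun z => (z - y) ^+ 2)).[y] <= h.
  rewrite bernstein_var nh mul1r add0r subrr expr0n/= add0r.
  rewrite expr2 mulrA nh mul1r -[leRHS]mulr1 ler_wpM2l// ?(ltW h0)//.
  by case/andP: hy; nra.
have Kh : K * h <= e / 2.
  by move: hn; rewrite ler_pdivrMr ?divr_gt0// -ler_pdivrMl ?ltr0Sn// mulrC.
have Kv := ler_wpM2l K0 var.
have up : 0 <= (bernstein h n.+1 0
   (fun z => (-1) * f z + K * (z - y) ^+ 2 + (e / 2 + f y))).[y].
  apply: bernstein_ge0; rewrite ?(ltW h0)// nh add0r => z /dom.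
  by rewrite ler_norml => /andP[]; lra.
have lo : 0 <= (bernstein h n.+1 0
   (fun z => 1 * f z + K * (z - y) ^+ 2 + (e / 2 - f y))).[y].
  apply: bernstein_ge0; rewrite ?(ltW h0)// nh add0r => z /dom.
  by rewrite ler_norml => /andP[]; lra.
by rewrite !bernstein_lin in up lo; rewrite ler_norml; apply/andP; split; lra.
Qed.

(** Compactness of the segment, in the form that a property holding near each
    point for all small parameters holds on the whole segment for some parameter. *)
Lemma continuous_itv_uniform (a b : R) (f : R -> R) :
  {within `[a, b], continuous f} -> uniformly_continuous_on a b f.
Proof.
move=> cf e e0.
have := @segment_compact R a b; rewrite compact_near_coveringP => cov.
have := cov R (0 : R)^'+ (fun d x => forall y, a <= x <= b -> a <= y <= b ->
  `|x - y| < d -> `|f x - f y| <= e) _.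
case.
- move=> x; rewrite /= in_itv /= => xab.
  have e2 : 0 < e / 2 by rewrite divr_gt0.
  have := cf x; rewrite /continuous_at.
  move=> /cvgrPdist_le /(_ _ e2) cfx.
  have xI : `[a, b]%classic x by rewrite /= in_itv.
  have : within `[a, b] (nbhs x) (fun y => `|f x - f y| <= e / 2).
    by rewrite (nbhs_subspace_in xI); exact: cfx.
  rewrite /within/= => /nbhs_ballP[d /= d0 hd].
  exists (ball x (d / 2), [set d' | d' < d / 2]) => /=.
    split; first by apply: nbhsx_ballx; rewrite divr_gt0.
    by apply: nbhs_right_lt; rewrite divr_gt0.
  move=> [z d'] [/= xz dd'] y zab yab zy.
  have xz' : `|x - z| < d / 2 by [].
  have := hd z; have := hd y; rewrite /ball/= !in_itv/=.
  have zlt : `|x - z| < d by lra.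
  have ylt : `|x - y| < d.
    have -> : x - y = (x - z) + (z - y) by ring.
    by have := ler_normD (x - z) (z - y); lra.
  move=> /(_ ylt yab) fy /(_ zlt zab) fz.
  have -> : f z - f y = (f x - f y) - (f x - f z) by ring.
  by have := ler_normB (f x - f y) (f x - f z); lra.
move=> d /= d0 hd; exists (d / 2); first by rewrite divr_gt0.
move=> x y xab yab xy; apply: (hd (d / 2)) xy => //=.
- by rewrite /ball/= sub0r normrN gtr0_norm; lra.
- by rewrite divr_gt0.
Qed.

Lemma continuous_itv_bounded (a b : R) (f : R -> R) : a <= b ->
  {within `[a, b], continuous f} ->
  exists M, forall x, a <= x <= b -> `|f x| <= M.
Proof.
move=> ab cf.
have [c _ hc] := EVT_max ab cf; have [d _ hd] := EVT_min ab cf.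
exists (`|f c| + `|f d|) => x xab.
have := hc x; have := hd x; rewrite !in_itv/= xab => /(_ isT) h1 /(_ isT) h2.
rewrite ler_norml; have := ler_norm (f c); have := lerNnormlW (lexx `|f d|).
by have := normr_ge0 (f c); have := normr_ge0 (f d); move=> *; apply/andP; split; lra.
Qed.

Theorem weierstrass (a b : R) (f : R -> R) : a < b ->
  {within `[a, b], continuous f} ->
  forall e : R, 0 < e -> exists p : {poly R},
    forall x, a <= x <= b -> `|p.[x] - f x| <= e.
Proof.
move=> ab cf e e0; have fu := continuous_itv_uniform cf.
have [M fM] := continuous_itv_bounded (ltW ab) cf.
set l := b - a; have l0 : 0 < l by rewrite subr_gt0.
have rng x : 0 <= x <= 1 -> a <= a + l * x <= b.
  by move=> /andP[x0 x1]; rewrite /l; apply/andP; split; nra.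
have [|p hp] := @weierstrass01 (fun x => f (a + l * x)) M (fun x hx => fM _ (rng x hx)) _ e e0.
  move=> e' /fu[d d0 hd]; exists (d / l); first by rewrite divr_gt0.
  move=> x y hx hy; rewrite ltr_pdivlMr// => xy; apply: hd; rewrite ?rng//.
  have -> : a + l * x - (a + l * y) = (x - y) * l by ring.
  by rewrite normrM (gtr0_norm l0).
exists (p \Po (l^-1 *: ('X - a%:P))) => x /andP[ax xb].
rewrite horner_comp !hornerE.
have := hp (l^-1 * (x - a)); rewrite mulrA mulfV ?gt_eqF// mul1r.
have -> : a + (x - a) = x by ring.
apply; rewrite mulr_ge0 ?invr_ge0 ?(ltW l0) ?subr_ge0//=.
by rewrite mulrC ler_pdivrMr// mul1r /l; lra.
Qed.

End Weierstrass.

(** * Real-valued geometry of the Hilbert space *)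

Section Hilbert.
Variables (R : realType) (Omega : Type) (H : rkhs R Omega).
Implicit Types (x y z : H).

(** Complex numbers are only partially ordered, so estimates are made with the
    real part of the inner product and the real value of the norm; [innerE]
    recovers the inner product from real parts. *)
Definition rip x y : R := complex.Re (inner H x y).
Definition nrm x : R := complex.Re `|x|.

Lemma nrmE x : `|x| = (nrm x)%:C.
Proof. by rewrite /nrm RRe_real// ger0_real. Qed.

Lemma nrm_ge0 x : 0 <= nrm x.
Proof. by rewrite -(@ler0c R) -nrmE. Qed.

Lemma inner_conj x y : inner H y x = (inner H x y)^*.
Proof. by rewrite (hermC (inner H)) expr0 mul1r. Qed.

Lemma innerDl x y z : inner H (x + y) z = inner H x z + inner H y z.
Proof. exact: linearDl. Qed.

Lemma innerZl a x z : inner H (a *: x) z = a * inner H x z.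
Proof. exact: linearZl_LR. Qed.

Lemma ripC x y : rip x y = rip y x.
Proof. by rewrite /rip inner_conj; case: (inner H y x). Qed.

Lemma ripDl x y z : rip (x + y) z = rip x z + rip y z.
Proof. by rewrite /rip innerDl raddfD. Qed.

Lemma ReZ (a : R) (u : R[i]) : complex.Re (a%:C * u) = a * complex.Re u.
Proof. by case: u => u v /=; rewrite mul0r subr0. Qed.

Lemma ripZl (a : R) x z : rip (a%:C *: x) z = a * rip x z.
Proof. by rewrite /rip innerZl ReZ. Qed.

Lemma ripDr x y z : rip z (x + y) = rip z x + rip z y.
Proof. by rewrite !(ripC z) ripDl. Qed.

Lemma ripZr (a : R) x z : rip z (a%:C *: x) = a * rip z x.
Proof. by rewrite !(ripC z) ripZl. Qed.

Lemma ripNl x z : rip (- x) z = - rip x z.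
Proof. by rewrite -scaleN1r -(rmorphN1 (real_complex R)) ripZl mulN1r. Qed.

Lemma ripNr x z : rip z (- x) = - rip z x.
Proof. by rewrite !(ripC z) ripNl. Qed.

Definition ripE := (ripDl, ripDr, ripNl, ripNr, ripZl, ripZr).

Lemma sqr_nrm x : nrm x ^+ 2 = rip x x.
Proof.
apply: complexI; rewrite -[LHS]/(real_complex R _) rmorphXn/= -nrmE sqr_norm_inner.
rewrite /rip RRe_real// ger0_real// -sqr_norm_inner exprn_ge0//.
Qed.

Lemma rip_ge0 x : 0 <= rip x x.
Proof. by rewrite -sqr_nrm exprn_ge0// nrm_ge0. Qed.

Lemma nrm_eq0 x : nrm x = 0 -> x = 0.
Proof. by move=> h; apply/normr0_eq0; rewrite nrmE h. Qed.

Lemma nrm0 : nrm 0 = 0.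
Proof. by rewrite /nrm normr0. Qed.

Lemma rip_eq0 x : rip x x = 0 -> x = 0.
Proof. by rewrite -sqr_nrm => /eqP; rewrite sqrf_eq0 => /eqP/nrm_eq0. Qed.

Lemma nrmD x y : nrm (x + y) <= nrm x + nrm y.
Proof. by rewrite -lecR rmorphD/= -!nrmE ler_normD. Qed.

Lemma cmodE (a : R[i]) : `|a| = (cmod a)%:C.
Proof. by []. Qed.

Lemma cmod_ge0 (a : R[i]) : 0 <= cmod a.
Proof. by rewrite -(@ler0c R) -cmodE. Qed.

Lemma nrmZ a x : nrm (a *: x) = cmod a * nrm x.
Proof.
by apply: complexI; rewrite -[LHS]/(real_complex R _) -nrmE normrZ cmodE nrmE -rmorphM.
Qed.

Lemma cmodR (a : R) : cmod a%:C = `|a|.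
Proof. by rewrite /cmod/= expr0n/= addr0 sqrtr_sqr. Qed.

Lemma nrmZr (a : R) x : nrm (a%:C *: x) = `|a| * nrm x.
Proof. by rewrite nrmZ cmodR. Qed.

Lemma nrmN x : nrm (- x) = nrm x.
Proof. by rewrite /nrm normrN. Qed.

Lemma nrmB x y : nrm (x - y) <= nrm x + nrm y.
Proof. by rewrite -(nrmN y) nrmD. Qed.

Lemma nrm_distC x y : nrm (x - y) = nrm (y - x).
Proof. by rewrite -nrmN opprB. Qed.

Lemma rip_CS x y : rip x y <= nrm x * nrm y.
Proof.
have [/nrm_eq0 ->|y0] := eqVneq (nrm y) 0.
  by rewrite nrm0 mulr0 -(scale0r x) -(rmorph0 (real_complex R)) ripZr mul0r.
have := rip_ge0 ((nrm y)%:C *: x - (nrm x)%:C *: y).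
rewrite !ripE -!sqr_nrm (ripC y x) => h.
have yp : 0 < nrm y by rewrite lt_def y0 nrm_ge0.
have [/nrm_eq0 ->|x0] := eqVneq (nrm x) 0.
  by rewrite nrm0 mul0r -(scale0r y) -(rmorph0 (real_complex R)) ripZl mul0r.
have xp : 0 < nrm x by rewrite lt_def x0 nrm_ge0.
rewrite -subr_ge0 -(pmulr_rge0 _ (mulr_gt0 xp yp)).
by nra.
Qed.

Lemma rip_CSn x y : - (nrm x * nrm y) <= rip x y.
Proof. by rewrite -(nrmN x) lerNl -ripNl rip_CS. Qed.

(** The real inequality for [c^* *: x], which rotates the inner product onto the
    positive axis. *)
Lemma inner_CS x y : cmod (inner H x y) <= nrm x * nrm y.
Proof.
set c := inner H x y.
have [->|c0] := eqVneq (cmod c) 0; first by rewrite mulr_ge0 ?nrm_ge0.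
have := rip_CS (c^* *: x) y; rewrite nrmZ {1}/rip innerZl -/c.
have cc : complex.Re (c^* * c) = cmod c ^+ 2.
  rewrite /cmod; case: (c) => a b /=; rewrite sqr_sqrtr ?addr_ge0 ?sqr_ge0//.
  by rewrite mulNr opprK.
have -> : cmod c^* = cmod c by rewrite /cmod; case: (c) => a b /=; rewrite sqrrN.
rewrite cc -mulrA expr2 ler_pM2l// lt_def c0; exact: cmod_ge0.
Qed.

Lemma rip_inj x y : (forall z, rip z x = rip z y) -> x = y.
Proof.
move=> h; apply/eqP; rewrite -subr_eq0; apply/eqP/rip_eq0.
by rewrite ripDr ripNr h subrr.
Qed.

Lemma innerE x y : inner H x y = Complex (rip x y) (- rip ('i *: x) y).
Proof.
rewrite {2}/rip innerZl /rip; case: (inner H x y) => a b /=.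
by rewrite mul0r mul1r sub0r opprK.
Qed.

Definition cvgs (u : nat -> H) (l : H) :=
  forall e : R, 0 < e -> exists N : nat, forall n, (N <= n)%N -> nrm (u n - l) <= e.

Lemma hilbert_complete (u : nat -> H) :
  (forall e : R, 0 < e -> exists N : nat, forall m n, (N <= m)%N -> (N <= n)%N ->
     nrm (u m - u n) <= e) ->
  exists l, cvgs u l.
Proof.
move=> hu.
have cu : cauchy (u @ \oo).
  apply/cauchy_ballP => e e0; rewrite near_map2.
  have eR : e = (complex.Re e)%:C by rewrite RRe_real// gtr0_real.
  have e2 : 0 < complex.Re e / 2 by rewrite divr_gt0// -ltcR -eR.
  have [N hN] := hu _ e2.
  exists ([set n | (N <= n)%N], [set n | (N <= n)%N]) => /=; first by split; exists N.
  move=> [m n] [/= hm hn]; rewrite -ball_normE/= nrmE eR ltcR.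
  by apply: le_lt_trans (hN _ _ hm hn) _; lra.
have /cauchy_cvgP/cvg_ex[l hl] := cu.
exists l => e e0.
have : \forall n \near \oo, `|l - u n| <= e%:C.
  by move/cvgrPdist_le : hl; apply; rewrite ltcR.
move=> [N _ hN]; exists N => n /hN/=.
by rewrite nrmE lecR nrm_distC.
Qed.

Section BoundedOp.
Variables (A : H -> H) (hA : bounded_operator A).

Lemma op_linear a x y : A (a *: x + y) = a *: A x + A y.
Proof. exact: (proj1 hA). Qed.

Lemma opD x y : A (x + y) = A x + A y.
Proof. by have := op_linear 1 x y; rewrite !scale1r. Qed.

Lemma op0 : A 0 = 0.
Proof. by have := op_linear (-1) 0 0; rewrite scaler0 addr0 scaleN1r addNr. Qed.

Lemma opZ a x : A (a *: x) = a *: A x.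
Proof. by have := op_linear a x 0; rewrite !addr0 op0 addr0. Qed.

Lemma opN x : A (- x) = - A x.
Proof. by rewrite -scaleN1r opZ scaleN1r. Qed.

Lemma opB x y : A (x - y) = A x - A y.
Proof. by rewrite opD opN. Qed.

Lemma op_bound : exists2 M : R, 0 <= M & forall x, nrm (A x) <= M * nrm x.
Proof.
have [_ [M hM]] := hA; exists (Num.max 0 (complex.Re M)); first by rewrite le_max lexx.
move=> x; have := hM x; rewrite !nrmE lecE => /andP[_].
rewrite mulrC /= ReZ mulrC => /le_trans; apply.
by rewrite ler_wpM2r ?nrm_ge0// le_max lexx orbT.
Qed.

End BoundedOp.

Lemma bounded_operator_intro (A : H -> H) (M : R) :
  (forall a x y, A (a *: x + y) = a *: A x + A y) ->
  (forall x, nrm (A x) <= M * nrm x) -> bounded_operator A.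
Proof.
by move=> Al AM; split=> //; exists M%:C => x; rewrite !nrmE -rmorphM lecR.
Qed.

Lemma bounded_comp (A B : H -> H) :
  bounded_operator A -> bounded_operator B -> bounded_operator (A \o B).
Proof.
move=> hA hB; have [M M0 hM] := op_bound hA; have [N N0 hN] := op_bound hB.
apply: (@bounded_operator_intro _ (M * N)) => [a x y|x] /=; first by rewrite !op_linear.
by apply: le_trans (hM _) _; rewrite -mulrA ler_wpM2l.
Qed.

Lemma bounded_lin (A B : H -> H) (a b : R[i]) :
  bounded_operator A -> bounded_operator B ->
  bounded_operator (fun x => a *: A x + b *: B x).
Proof.
move=> hA hB; have [M M0 hM] := op_bound hA; have [N N0 hN] := op_bound hB.
apply: (@bounded_operator_intro _ (cmod a * M + cmod b * N)) => [c x y|x] /=.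
  by rewrite (op_linear hA) (op_linear hB) !scalerDr !scalerA [a * c]mulrC [b * c]mulrC addrACA.
apply: le_trans (nrmD _ _) _; rewrite !nrmZ mulrDl -!mulrA.
by apply: lerD; rewrite ler_wpM2l ?cmod_ge0.
Qed.

Lemma bounded_id : bounded_operator (idfun : H -> H).
Proof. by apply: (@bounded_operator_intro _ 1) => // x; rewrite mul1r. Qed.

(** Stated with real parts, this is equivalent for linear operators to the
    relation for the inner product, see [adj_inner]. *)
Definition adj (A S : H -> H) := forall x y, rip (A x) y = rip x (S y).
Definition selfadj (A : H -> H) := bounded_operator A /\ adj A A.

(** Minimise [J x = <D x, x> - 2 phi x] over the closed subspace [V].
    Coercivity bounds [J] below and, by the parallelogram identity, makes a
    minimising sequence Cauchy; at the limit the first variation of [J] vanishes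
    in all directions of [V].  With [V] the whole space and [D] the identity this
    is the Riesz representation theorem, with [V] the whole space it solves
    [D z = y], and with [D] the identity it gives the orthogonal projection
    on [V]. *)
Lemma form_riesz (V : set H) (D : H -> H) (phi : H -> R) (c K : R) :
  V 0 -> (forall x y (a : R), V x -> V y -> V (x + a%:C *: y)) ->
  (forall u l, (forall n, V (u n)) -> cvgs u l -> V l) ->
  selfadj D -> 0 < c -> (forall x, c * nrm x ^+ 2 <= rip (D x) x) ->
  (forall x y (a : R), phi (x + a%:C *: y) = phi x + a * phi y) ->
  (forall x, `|phi x| <= K * nrm x) ->
  exists2 z, V z & forall x, V x -> phi x = rip x (D z).
Proof.
move=> V0 Vl Vc [bD sD] c0 Dc phil phiK.
pose J x := rip (D x) x - 2 * phi x.
have Jexp x y (a : R) :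
    J (x + a%:C *: y) = J x + 2 * a * (rip (D x) y - phi y) + a ^+ 2 * rip (D y) y.
  by rewrite /J (opD bD) (opZ bD) !ripE phil (sD y x) (ripC y (D x)); ring.
have Jlb x : - (K ^+ 2 / c) <= J x.
  have h1 := Dc x; have := phiK x; rewrite ler_norml => /andP[_ h2].
  rewrite -mulNr ler_pdivrMr// /J.
  have := sqr_ge0 (c * nrm x - K).
  by nra.
pose S : set R := J @` V.
have infS : has_inf S.
  split; first by exists (J 0); exists 0.
  by exists (- (K ^+ 2 / c)) => _ [x _ <-].
have mJ x : V x -> inf S <= J x by move=> Vx; apply: (ge_inf (proj2 infS)); exists x.
have /choice[u hu] (n : nat) : exists x, V x /\ J x <= inf S + n.+1%:R^-1.
  have [_ [x Vx <-] h] := @inf_adherent _ S n.+1%:R^-1 (ltac:(by rewrite invr_gt0)) infS.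
  by exists x; split => //; exact: ltW.
have Vu n : V (u n) by case: (hu n).
(* The midpoint of [u m] and [u n] is in [V], so [J] there is at least the
   infimum. *)
have par m n : c / 2 * nrm (u m - u n) ^+ 2 <= m.+1%:R^-1 + n.+1%:R^-1.
  have [Vm Jm] := hu m; have [Vn Jn] := hu n.
  set w := u m - u n.
  have Vh : V (u n + (2^-1)%:C *: w).
    rewrite (_ : _ + _ = (0 + (2^-1)%:C *: u n) + (2^-1)%:C *: u m).
      by apply: (Vl) => //; apply: (Vl).
    rewrite /w scalerBr add0r addrCA [RHS]addrC; congr (_ + _).
    rewrite -{1}(scale1r (u n)) -scalerBl; congr (_ *: _).
    by rewrite -(rmorph1 (real_complex R)) -rmorphB/=; congr (_ %:C); field.
  have := mJ _ Vh; rewrite Jexp => h1.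
  have h2 : J (u m) = J (u n + 1%:C *: w) by rewrite scale1r /w addrC subrK.
  rewrite h2 Jexp in Jm.
  have := Dc w; set q := rip (D w) w in Jm h1 *; set g := rip _ _ - _ in Jm h1.
  move: Jm Jn h1.
  by move: (J (u n)) (inf S) n.+1%:R^-1 m.+1%:R^-1 (nrm w ^+ 2) => *; lra.
have [z hz] : exists l, cvgs u l.
  apply: hilbert_complete => e e0.
  have ce : 0 < c * e ^+ 2 / 4 by rewrite divr_gt0// mulr_gt0// exprn_gt0.
  have [N hN] := invn_small ce; exists N => m n /hN hm /hN hn.
  have hp := par m n.
  rewrite -(@ler_pXn2r _ 2)// ?nnegrE ?nrm_ge0 ?(ltW e0)//.
  rewrite -(ler_pM2l c0); move: hp hm hn.
  by move: n.+1%:R^-1 m.+1%:R^-1 (e ^+ 2) (nrm _ ^+ 2) => *; lra.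
have Vz : V z by apply: Vc hz.
exists z => // y Vy; rewrite ripC; apply/eqP; rewrite -subr_eq0 -oppr_eq0 opprB; apply/eqP.
set g := rip (D z) y - phi y; set q := rip (D y) y.
have q0 : 0 <= q by apply: le_trans (Dc y); rewrite mulr_ge0 ?(ltW c0) ?sqr_ge0.
have [M M0 hM] := op_bound bD.
(* Optimality at the limit: compare [J (u n + a y)] with the infimum and let [n]
   grow. *)
have key (a : R) : 0 <= 2 * a * g + a ^+ 2 * q.
  apply/ler_addgt0Pr => e e0.
  have e2 : 0 < e / 2 by rewrite divr_gt0.
  have [N1 hN1] := invn_small e2.
  set L := 2 * `|a| * M * nrm y + 1.
  have L0 : 0 < L by rewrite ltr_wpDl// !mulr_ge0// nrm_ge0.
  have [N2 hN2] := hz (e / 2 / L) (divr_gt0 e2 L0).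
  set n := maxn N1 N2.
  have := hN1 n (leq_maxl _ _); have := hN2 n (leq_maxr _ _) => hun hn1.
  have [Vn Jn] := hu n.
  have Vny : V (u n + a%:C *: y) by exact: Vl.
  have := mJ _ Vny; rewrite Jexp -/q => h1.
  have h2 : rip (D (u n)) y - phi y = g + rip (D (u n - z)) y.
    by rewrite /g (opB bD) ripDl ripNl; ring.
  rewrite h2 in h1.
  have h3 : `|rip (D (u n - z)) y| <= M * nrm (u n - z) * nrm y.
    rewrite ler_norml; have := rip_CS (D (u n - z)) y; have := rip_CSn (D (u n - z)) y.
    have : nrm (D (u n - z)) * nrm y <= M * nrm (u n - z) * nrm y.
      by rewrite ler_wpM2r ?nrm_ge0.
    by move=> *; apply/andP; split; lra.
  have h4 : 2 * a * rip (D (u n - z)) y <= e / 2.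
    apply: (le_trans (ler_norm _)); rewrite !normrM (ger0_norm (ler0n _ 2)).
    apply: (@le_trans _ _ (L * nrm (u n - z))); last first.
      by rewrite mulrC -ler_pdivlMr.
    apply: (@le_trans _ _ (2 * `|a| * (M * nrm (u n - z) * nrm y))).
      by rewrite ler_wpM2l// mulr_ge0.
    rewrite /L; have := nrm_ge0 (u n - z); nra.
  move: h1 hn1 Jn h4; rewrite mulrDr.
  by move: (J (u n)) (inf S) n.+1%:R^-1 (2 * a * _) (2 * a * _) (a ^+ 2 * q) => *; lra.
(* This step would make [2 a g + a^2 q] negative unless [g = 0]; [q + 1] rather
   than [q] because [q] may vanish. *)
have := key (- g / (q + 1)); have q1 : 0 < q + 1 by lra.
move=> h; have : 0 <= (2 * (- g / (q + 1)) * g + (- g / (q + 1)) ^+ 2 * q) * (q + 1) ^+ 2.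
  by rewrite mulr_ge0// sqr_ge0.
have -> : (2 * (- g / (q + 1)) * g + (- g / (q + 1)) ^+ 2 * q) * (q + 1) ^+ 2
   = - (g ^+ 2 * (q + 2)) by field; rewrite gt_eqF.
rewrite oppr_ge0 pmulr_lle0; last by lra.
by move=> g2; apply/eqP; rewrite -sqrf_eq0 eq_le g2 sqr_ge0.
Qed.

End Hilbert.

(** * Riesz representation, adjoints, coercive inverses, projections *)

Section Adjoint.
Variables (R : realType) (Omega : Type) (H : rkhs R Omega).
Implicit Types (x y z : H) (A S T U D : H -> H).

Lemma ripZc a x y : rip x (a *: y) = rip (a^* *: x) y.
Proof.
by rewrite /rip innerZl (inner_conj (a *: y)) innerZl rmorphM/= -inner_conj.
Qed.

(** The identity for real parts at [x] and at ['i x] gives it for the inner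
    product. *)
Lemma adj_inner A S : bounded_operator A -> adj A S ->
  forall x y, inner H (A x) y = inner H x (S y).
Proof. by move=> bA AS x y; rewrite !innerE -(opZ bA) !AS. Qed.

Lemma adjC A S : adj A S -> adj S A.
Proof. by move=> h x y; rewrite ripC -h ripC. Qed.

Lemma adj_uniq A S S' : adj A S -> adj A S' -> S = S'.
Proof.
by move=> h h'; apply/funext => y; apply: rip_inj => x; rewrite -h h'.
Qed.

Lemma adj_comp A S B T : adj A S -> adj B T -> adj (A \o B) (T \o S).
Proof. by move=> h h' x y /=; rewrite h h'. Qed.

Lemma nrm_le_rip x (M : R) : 0 <= M -> rip x x <= M * nrm x -> nrm x <= M.
Proof.
move=> M0; rewrite -sqr_nrm expr2; have [->|x0] := eqVneq (nrm x) 0 => //.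
by rewrite ler_pM2r// lt_def x0 nrm_ge0.
Qed.

Lemma selfadj_id : selfadj (idfun : H -> H).
Proof. by split=> //; exact: bounded_id. Qed.

Lemma riesz_solve D (c : R) (phi : H -> R) K : selfadj D -> 0 < c ->
  (forall x, c * nrm x ^+ 2 <= rip (D x) x) ->
  (forall x y (a : R), phi (x + a%:C *: y) = phi x + a * phi y) ->
  (forall x, `|phi x| <= K * nrm x) ->
  exists z, forall x, phi x = rip x (D z).
Proof.
move=> sD c0 Dc phil phiK.
have [//|//|//|z _ hz] := @form_riesz _ _ H setT D phi c K _ _ _ sD c0 Dc phil phiK.
by exists z => x; exact: hz.
Qed.

Lemma rip_abs x y : `|rip x y| <= nrm x * nrm y.
Proof. by rewrite ler_norml rip_CS rip_CSn. Qed.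

Lemma adj_exists A : bounded_operator A ->
  exists2 S, bounded_operator S & adj A S.
Proof.
move=> bA; have [M M0 hM] := op_bound bA.
have /choice[S hS] y : exists z, forall x, rip (A x) y = rip x z.
  apply: (@riesz_solve idfun 1 (fun x => rip (A x) y) (M * nrm y) selfadj_id) => //.
  - by move=> x; rewrite mul1r sqr_nrm.
  - by move=> x z a; rewrite (opD bA) (opZ bA) !ripE.
  - move=> x; apply: le_trans (rip_abs _ _) _.
    by rewrite mulrAC ler_wpM2r ?nrm_ge0.
exists S => [|x y]; last exact: hS.
apply: (@bounded_operator_intro _ _ H S M) => [a x y|y].
  apply: rip_inj => z; rewrite -hS ripDr ripZc -(opZ bA) !hS.
  by rewrite ripDr -ripZc.
apply: nrm_le_rip; first by rewrite mulr_ge0 ?nrm_ge0.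
rewrite -hS; apply: le_trans (rip_CS _ _) _.
by rewrite mulrAC ler_wpM2r ?nrm_ge0.
Qed.

(** The representing vectors of the functionals [<A _, y>] form a bounded
    adjoint, so the chosen one has the defining property. *)
Lemma adjointP A : bounded_operator A ->
  bounded_operator (adjoint A) /\ adj A (adjoint A).
Proof.
move=> bA; have [S bS AS] := adj_exists bA.
have [b h] : [set S : H -> H | bounded_operator S /\
    forall x y : H, inner H (A x) y = inner H x (S y)] (adjoint A).
  by apply: getPex; exists S; split=> //; exact: adj_inner.
by split=> // x y; rewrite /rip h.
Qed.

Lemma adjointE A S : bounded_operator A -> adj A S -> adjoint A = S.
Proof. by move=> /adjointP[_ h] h'; apply: adj_uniq h h'. Qed.

Lemma adjointK A : bounded_operator A -> adjoint (adjoint A) = A.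
Proof. by move=> /adjointP[b h]; apply: adjointE => //; exact: adjC. Qed.

Lemma coercive_inverse D (c : R) : selfadj D -> 0 < c ->
  (forall x, c * nrm x ^+ 2 <= rip (D x) x) ->
  exists S, bounded_operator S /\ (forall x, S (D x) = x) /\ (forall x, D (S x) = x).
Proof.
move=> sD c0 Dc; have bD := proj1 sD.
have /choice[S hS] y : exists z, D z = y.
  have [|x|z hz] := @riesz_solve D c (fun x => rip x y) (nrm y) sD c0 Dc.
  - by move=> x z a; rewrite !ripE.
  - by rewrite mulrC rip_abs.
  by exists z; apply: rip_inj.
have Dlow x : nrm x <= c^-1 * nrm (D x).
  apply: nrm_le_rip; first by rewrite mulr_ge0 ?nrm_ge0 ?invr_ge0 ?ltW.
  rewrite -mulrA ler_pdivlMl// -sqr_nrm; apply: le_trans (Dc x) _.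
  exact: rip_CS.
have Dinj x y : D x = D y -> x = y.
  move=> h; apply/eqP; rewrite -subr_eq0; apply/eqP/nrm_eq0/eqP.
  have := Dlow (x - y); rewrite (opB bD) h subrr nrm0 mulr0 => h1.
  by rewrite eq_le h1 nrm_ge0.
exists S; split; last by split => x; [apply: Dinj; rewrite hS | rewrite hS].
apply: (@bounded_operator_intro _ _ H S c^-1) => [a x y|x].
  by apply: Dinj; rewrite (op_linear bD) !hS.
by apply: le_trans (Dlow _) _; rewrite hS.
Qed.

Lemma selfadj_lin T T' (a b : R) : selfadj T -> selfadj T' ->
  selfadj (fun x => a%:C *: T x + b%:C *: T' x).
Proof.
move=> [bT sT] [bT' sT']; split; first exact: bounded_lin.
by move=> x y; rewrite !ripE sT sT'.
Qed.

Definition form_between (a b : R) T :=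
  forall x, a * nrm x ^+ 2 <= rip (T x) x <= b * nrm x ^+ 2.

(** For [z < a] the operator [T - z], and for [z > b] the operator [z - T], is
    coercive, hence boundedly invertible. *)
Lemma spectrum_itv T (a b z : R) : selfadj T -> form_between a b T ->
  spectrum T z%:C -> a <= z <= b.
Proof.
move=> sT Tab; rewrite /spectrum/= => hz; apply/andP; split; rewrite leNgt; apply/negP => zlt.
- apply: hz; have sD := selfadj_lin 1 (- z) sT selfadj_id.
  have [|x|S [bS [SD DS]]] := coercive_inverse (c := a - z) sD.
  + by rewrite subr_gt0.
  + by rewrite !ripE -sqr_nrm; have /andP[] := Tab x; lra.
  exists S; split=> //; split=> x.
    by rewrite -[RHS]SD/= scale1r rmorphN scaleNr.
  by rewrite -[RHS]DS/= scale1r rmorphN scaleNr.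
- apply: hz; have sD := selfadj_lin (-1) z sT selfadj_id.
  have [|x|S [bS [SD DS]]] := coercive_inverse (c := z - b) sD.
  + by rewrite subr_gt0.
  + by rewrite !ripE -sqr_nrm; have /andP[] := Tab x; lra.
  exists (fun x => - S x); split; last split=> x.
  + by have := bounded_lin (-1) 0 bS bS; congr bounded_operator; apply/funext => x;
      rewrite scale0r addr0 scaleN1r.
  + rewrite -(opN bS) -[RHS]SD/=; congr S.
    by rewrite rmorphN1 scaleN1r opprB addrC.
  + by rewrite -[RHS]DS/= rmorphN1 scaleN1r (opN (proj1 sT)) scalerN opprK.
Qed.

Lemma projection (V : set H) : V 0 ->
  (forall x y (a : R), V x -> V y -> V (x + a%:C *: y)) ->
  (forall u l, (forall n, V (u n)) -> cvgs u l -> V l) ->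
  forall y, exists2 z, V z & forall x, V x -> rip x (y - z) = 0.
Proof.
move=> V0 Vl Vc y.
have [|||x|z Vz hz] := form_riesz (phi := fun x => rip x y) (c := 1) (K := nrm y) V0 Vl Vc selfadj_id.
- exact: ltr01.
- by move=> x; rewrite mul1r sqr_nrm.
- by move=> x z a; rewrite !ripE.
- by rewrite mulrC rip_abs.
by exists z => // x /hz h; rewrite ripDr ripNr h subrr.
Qed.

(** Remove from [x] its orthogonal projection on the kernel of [U]: the image is
    unchanged, and [U] is isometric on what remains. *)
Lemma partial_isometry_contraction U : partial_isometry U ->
  forall x, nrm (U x) <= nrm x.
Proof.
move=> [bU Ui] x; have [M M0 hM] := op_bound bU.
have [||u l hu ul|z /= Uz hz] := @projection [set x | U x = 0] _ _ _ x.
- exact: op0 bU.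
- by move=> y z a /= hy hz; rewrite (opD bU) (opZ bU) hy hz scaler0 addr0.
- apply: nrm_eq0; apply/eqP; rewrite eq_le nrm_ge0 andbT.
  apply/ler_addgt0Pr => e e0; rewrite add0r.
  have M1 : 0 < M + 1 by lra.
  have [N /(_ N (leqnn N))] := ul (e / (M + 1)) (divr_gt0 e0 M1).
  rewrite nrm_distC ler_pdivlMr// => h.
  have := hM (l - u N); rewrite (opB bU) hu subr0.
  by have := nrm_ge0 (l - u N); nra.
set w := x - z in hz.
have -> : U x = U w by rewrite /w (opB bU) Uz subr0.
have -> : nrm (U w) = nrm w.
  rewrite /nrm Ui// => y Uy; rewrite inner_conj innerE hz//.
  rewrite hz ?oppr0 ?conjc0//.
  by rewrite /= (opZ bU) Uy scaler0.
have : nrm w ^+ 2 <= nrm x ^+ 2.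
  have xw : x = z + w by rewrite /w addrC subrK.
  move: w hz xw => w hz ->.
  by rewrite !sqr_nrm !ripE (ripC w z) (hz z Uz); have := rip_ge0 z; lra.
by rewrite ler_pXn2r// ?nnegrE ?nrm_ge0.
Qed.

(** A contraction [U] that preserves the norm of [x] has [x] in its initial
    space: expanding [||V U x - x||^2] leaves at most [0].  For a polar
    decomposition [A = U |A|] this applies to the range of [|A|], because
    [|A| x] and [A x] have the same norm. *)
Lemma contraction_isometric U V x : adj U V ->
  (forall y, nrm (V y) <= nrm y) -> nrm (U x) = nrm x -> V (U x) = x.
Proof.
move=> UV cV hx; apply/eqP; rewrite -subr_eq0; apply/eqP/rip_eq0.
have h1 : rip (V (U x)) x = nrm x ^+ 2 by rewrite ripC -UV -sqr_nrm hx.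
have h2 : nrm (V (U x)) ^+ 2 <= nrm x ^+ 2.
  by rewrite -hx ler_pXn2r// ?nnegrE ?nrm_ge0.
have := rip_ge0 (V (U x) - x); rewrite !ripE (ripC x) h1 -!sqr_nrm => h3.
by lra.
Qed.

Lemma contraction_adj U V : adj U V ->
  (forall y, nrm (U y) <= nrm y) -> forall y, nrm (V y) <= nrm y.
Proof.
move=> UV cU y; apply: nrm_le_rip; first exact: nrm_ge0.
rewrite -UV; apply: le_trans (rip_CS _ _) _.
by rewrite mulrC ler_wpM2l ?nrm_ge0.
Qed.

End Adjoint.

(** * Polynomials of an operator and the spectral bound *)

Section PolyCalculus.
Variables (R : realType) (Omega : Type) (H : rkhs R Omega).
Implicit Types (x y v : H) (T W : H -> H) (z : R[i]).

(** Complex coefficients are needed to split polynomials into linear factors. *)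
Definition cpoly_op (p : {poly R[i]}) T : H -> H :=
  fun x => \sum_(i < size p) p`_i *: iter i T x.

Lemma cpoly_op_widen n (p : {poly R[i]}) T x : (size p <= n)%N ->
  cpoly_op p T x = \sum_(i < n) p`_i *: iter i T x.
Proof.
move=> pn; rewrite /cpoly_op (big_ord_widen n (fun i => p`_i *: iter i T x))//.
rewrite big_mkcond/=; apply: eq_bigr => i _.
by case: ltnP => // hi; rewrite nth_default// scale0r.
Qed.

Lemma cpoly_opD p q T x : cpoly_op (p + q) T x = cpoly_op p T x + cpoly_op q T x.
Proof.
set n := maxn (size p) (size q).
rewrite !(@cpoly_op_widen n) ?leq_maxl ?leq_maxr// ?size_polyD//.
by rewrite -big_split/=; apply: eq_bigr => i _; rewrite coefD scalerDl.
Qed.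

Lemma cpoly_opC c T x : cpoly_op c%:P T x = c *: x.
Proof.
by rewrite (@cpoly_op_widen 1) ?size_polyC_leq1// big_ord1 coefC.
Qed.

Lemma cpoly_opMX p T x : cpoly_op (p * 'X) T x = cpoly_op p T (T x).
Proof.
rewrite (@cpoly_op_widen (size p).+1); last first.
  by have [->|p0] := eqVneq p 0; rewrite ?mul0r ?size_poly0 ?size_mulX.
rewrite big_ord_recl coefMX scale0r add0r; apply: eq_bigr => i _.
by rewrite coefMX/= -iterS iterSr.
Qed.

Lemma cpoly_op_step p c T x :
  cpoly_op (p * 'X + c%:P) T x = cpoly_op p T (T x) + c *: x.
Proof. by rewrite cpoly_opD cpoly_opMX cpoly_opC. Qed.

Lemma cpoly_op0 T x : cpoly_op 0 T x = 0.
Proof. by rewrite -polyC0 cpoly_opC scale0r. Qed.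

Lemma cpoly_op_bounded p T : bounded_operator T -> bounded_operator (cpoly_op p T).
Proof.
move=> bT; elim/poly_ind: p => [|p c IH].
  rewrite (_ : cpoly_op 0 T = fun x => 0 *: x + 0 *: x).
    by apply: bounded_lin; exact: bounded_id.
  by apply/funext => x; rewrite cpoly_op0 !scale0r addr0.
rewrite (_ : cpoly_op _ T = fun x => 1 *: (cpoly_op p T \o T) x + c *: x).
  by apply: bounded_lin; [exact: bounded_comp | exact: bounded_id].
by apply/funext => x; rewrite cpoly_op_step scale1r.
Qed.

Lemma cpoly_op_intertwine p T T' W : bounded_operator W ->
  (forall x, T (W x) = W (T' x)) ->
  forall x, cpoly_op p T (W x) = W (cpoly_op p T' x).
Proof.
move=> bW TW; elim/poly_ind: p => [|p c IH] x; first by rewrite !cpoly_op0 (op0 bW).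
by rewrite !cpoly_op_step TW IH (opD bW) (opZ bW).
Qed.

Lemma cpoly_opZ c p T x : cpoly_op (c%:P * p) T x = c *: cpoly_op p T x.
Proof.
elim/poly_ind: p x => [|p d IH] x; first by rewrite mulr0 !cpoly_op0 scaler0.
by rewrite mulrDr mulrA -polyCM !cpoly_op_step IH scalerDr scalerA.
Qed.

Lemma cpoly_opM p q T x : bounded_operator T ->
  cpoly_op (p * q) T x = cpoly_op p T (cpoly_op q T x).
Proof.
move=> bT; elim/poly_ind: p x => [|p c IH] x; first by rewrite mul0r !cpoly_op0.
rewrite mulrDl cpoly_opD cpoly_opZ cpoly_op_step mulrAC cpoly_opMX IH.
by rewrite (@cpoly_op_intertwine q T T T).
Qed.

Definition bounded_below T := exists2 c : R, 0 < c & forall x, c * nrm x <= nrm (T x).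

(** Split [P] into linear factors: a composite of operators that are bounded
    below is bounded below. *)
Lemma cpoly_op_bounded_below P T : bounded_operator T -> P != 0 ->
  (forall z, root P z -> bounded_below (fun x => T x - z *: x)) ->
  bounded_below (cpoly_op P T).
Proof.
move=> bT P0 hP; have [s Ps] := closed_field_poly_normal P.
have {}hP z : z \in s -> bounded_below (fun x => T x - z *: x).
  by move=> zs; apply: hP; rewrite Ps rootZ ?lead_coef_eq0// root_prod_XsubC.
rewrite Ps -mul_polyC.
suff [c c0 hc] : bounded_below (cpoly_op (\prod_(z <- s) ('X - z%:P)) T).
  have l0 : 0 < cmod (lead_coef P).
    rewrite lt_def cmod_ge0 andbT; apply: contra P0 => /eqP h.
    by rewrite -lead_coef_eq0 -normr_eq0 cmodE h.
  exists (cmod (lead_coef P) * c); first by rewrite mulr_gt0.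
  by move=> x; rewrite cpoly_opZ nrmZ -mulrA ler_pM2l.
elim: s {Ps} hP => [|z s IH] hs.
  by rewrite big_nil; exists 1 => // x; rewrite -polyC1 cpoly_opC scale1r mul1r.
have [|c c0 hc] := IH; first by move=> u us; apply: hs; rewrite inE us orbT.
have [d d0 hd] := hs z (mem_head _ _).
rewrite big_cons; exists (d * c); first by rewrite mulr_gt0.
move=> x; rewrite cpoly_opM//.
rewrite -[X in X - _]mul1r -polyC1 -polyCN cpoly_op_step polyC1 cpoly_opC scale1r scaleNr.
by apply: le_trans (hd _); rewrite -mulrA ler_pM2l.
Qed.

Lemma not_spectrum_bounded_below T z : ~ spectrum T z ->
  bounded_below (fun x => T x - z *: x).
Proof.
rewrite /spectrum/= => /contrapT[S [bS [SD _]]].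
have [M M0 hM] := op_bound bS.
have M1 : 0 < M + 1 by lra.
exists (M + 1)^-1; first by rewrite invr_gt0.
move=> x; rewrite ler_pdivrMl//; have := hM (T x - z *: x); rewrite SD.
by have := nrm_ge0 (T x - z *: x); lra.
Qed.

Lemma rip_selfadj_i T x : selfadj T -> rip (T x) ('i *: x) = 0.
Proof.
move=> [bT sT].
have h : rip (T x) ('i *: x) = - rip (T x) ('i *: x).
  rewrite {1}sT (opZ bT) ripZc conjCi.
  by rewrite scaleNr ripNl ripC.
by lra.
Qed.

(** [<T x, i x>] has real part [0], so the real part of [<(T - z) x, i x>] is
    [- Im z ||x||^2]. *)
Lemma nonreal_bounded_below T z : selfadj T -> complex.Im z != 0 ->
  bounded_below (fun x => T x - z *: x).
Proof.
move=> sT z0; exists `|complex.Im z|; first by rewrite normr_gt0.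
move=> x; have ni : nrm ('i *: x) = nrm x.
  by rewrite /nrm normrZ normCi mul1r.
have : `|rip (T x - z *: x) ('i *: x)| <= nrm (T x - z *: x) * nrm x.
  by rewrite -ni; exact: rip_abs.
have -> : rip (T x - z *: x) ('i *: x) = - (complex.Im z * nrm x ^+ 2).
  rewrite ripDl ripNl rip_selfadj_i// add0r; congr (- _).
  have -> : z *: x = (complex.Re z)%:C *: x + (complex.Im z)%:C *: ('i *: x).
    rewrite scalerA -scalerDl; congr (_ *: _).
    by rewrite [X in _ + X]mulrC; exact: complexE.
  rewrite !ripE -sqr_nrm ni (rip_selfadj_i x (selfadj_id H)).
  by rewrite mulr0 add0r.
rewrite normrN normrM (ger0_norm (sqr_ge0 _)) expr2 mulrA.
have [->|x0] := eqVneq (nrm x) 0; first by rewrite !mulr0 nrm_ge0.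
by rewrite ler_pM2r// lt_def x0 nrm_ge0.
Qed.

Local Notation "p ^toC" := (map_poly (real_complex R) p) (at level 2, format "p ^toC").

Lemma poly_opE (p : {poly R}) T : poly_op p T = cpoly_op p^toC T.
Proof.
apply/funext => x; rewrite /poly_op /cpoly_op size_map_inj_poly//; last exact: complexI.
by apply: eq_bigr => i _; rewrite coef_map.
Qed.

Lemma poly_opD p q T x : poly_op (p + q) T x = poly_op p T x + poly_op q T x.
Proof. by rewrite !poly_opE rmorphD/= cpoly_opD. Qed.

Lemma poly_opC (c : R) T x : poly_op c%:P T x = c%:C *: x.
Proof. by rewrite !poly_opE map_polyC/= cpoly_opC. Qed.

Lemma poly_opM p q T x : bounded_operator T ->
  poly_op (p * q) T x = poly_op p T (poly_op q T x).
Proof. by move=> bT; rewrite !poly_opE rmorphM/= cpoly_opM. Qed.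

Lemma poly_opX T x : poly_op 'X T x = T x.
Proof.
by rewrite poly_opE map_polyX -['X]mul1r cpoly_opMX -polyC1 cpoly_opC scale1r.
Qed.

Lemma poly_opZ (c : R) p T x : poly_op (c *: p) T x = c%:C *: poly_op p T x.
Proof. by rewrite !poly_opE -mul_polyC rmorphM/= map_polyC cpoly_opZ. Qed.

Lemma poly_opB p q T x : poly_op (p - q) T x = poly_op p T x - poly_op q T x.
Proof.
by rewrite poly_opD -scaleN1r poly_opZ rmorphN1 scaleN1r.
Qed.

Lemma poly_op_intertwine p T T' W : bounded_operator W ->
  (forall x, T (W x) = W (T' x)) ->
  forall x, poly_op p T (W x) = W (poly_op p T' x).
Proof. by move=> bW h x; rewrite !poly_opE; exact: cpoly_op_intertwine. Qed.

Lemma poly_op_bounded p T : bounded_operator T -> bounded_operator (poly_op p T).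
Proof. by move=> bT; rewrite poly_opE; exact: cpoly_op_bounded. Qed.

Lemma poly_op_selfadj p T : selfadj T -> selfadj (poly_op p T).
Proof.
move=> [bT sT]; split; first exact: poly_op_bounded.
elim/poly_ind: p => [|p c IH] x y.
  by rewrite -polyC0 !poly_opC !ripE !mul0r.
rewrite !poly_opD !poly_opC !ripE !(@poly_opM p 'X)// !poly_opX IH sT.
by rewrite (@poly_op_intertwine p T T T).
Qed.

(** Let [N = ||q(T)||] and suppose [N > e].  No root of [q^2 - N^2] is in the
    spectrum, for there [|q| <= e]; so [q(T)^2 - N^2] is bounded below by some
    [d > 0].  But [||(q(T)^2 - N^2) v||^2 <= N^2 (N^2 ||v||^2 - ||q(T) v||^2)],
    which then keeps [||q(T) v||] away from [N] on the unit ball.  The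
    polynomial must not be constant, for otherwise [q^2 - N^2] could be [0]. *)
Lemma spectral_bound_size (q : {poly R}) T (e : R) : selfadj T -> (1 < size q)%N ->
  (forall x : R, spectrum T x%:C -> `|q.[x]| <= e) -> 0 <= e ->
  forall v, nrm (poly_op q T v) <= e * nrm v.
Proof.
move=> sT q1 qe e0 v0; rewrite leNgt; apply/negP => hv0.
have sQ := poly_op_selfadj q sT; set Q := poly_op q T in hv0 sQ.
have [bQ aQ] := sQ; have [M M0 hM] := op_bound bQ.
have v00 : 0 < nrm v0.
  rewrite lt_def nrm_ge0 andbT; apply/eqP => /nrm_eq0 v00.
  by move: hv0; rewrite v00 (op0 bQ) nrm0 mulr0 ltxx.
pose S : set R := [set nrm (Q v) | v in [set v | nrm v <= 1]].
have supS : has_sup S.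
  split; first by exists (nrm (Q 0)); exists 0 => //=; rewrite nrm0 ler01.
  exists M => _ [v /= v1 <-]; apply: le_trans (hM v) _.
  by rewrite -[leRHS]mulr1 ler_wpM2l.
pose N := sup S.
have QN v : nrm (Q v) <= N * nrm v.
  have [v0'|vn] := eqVneq (nrm v) 0.
    by rewrite v0' mulr0 (nrm_eq0 v0') (op0 bQ) nrm0.
  have vp : 0 < nrm v by rewrite lt_def vn nrm_ge0.
  have : S (nrm (Q ((nrm v)^-1%:C *: v))).
    exists ((nrm v)^-1%:C *: v) => //=.
    by rewrite nrmZr gtr0_norm ?invr_gt0// mulVf.
  move=> /(ub_le_sup (proj2 supS)).
  by rewrite (opZ bQ) nrmZr gtr0_norm ?invr_gt0// mulrC ler_pdivrMr.
have eN : e < N by rewrite -(ltr_pM2r v00); exact: lt_le_trans hv0 (QN _).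
have N0 : 0 < N by apply: le_lt_trans eN.
pose P : {poly R} := q * q - (N ^+ 2)%:P.
have P0 : P != 0.
  apply/eqP => /eqP; rewrite subr_eq0 => /eqP h.
  have := size_polyC_leq1 (N ^+ 2); rewrite -h size_mul; last first.
  - by rewrite -size_poly_gt0 (ltn_trans _ q1).
  - by rewrite -size_poly_gt0 (ltn_trans _ q1).
  by move: q1; case: (size q) => [|[|n]] _ //; rewrite !addSn !addnS.
have [d d0 hd] : bounded_below (cpoly_op P^toC T).
  apply: cpoly_op_bounded_below; first exact: (proj1 sT).
  - by rewrite map_poly_eq0.
  move=> z rz; have [iz|] := eqVneq (complex.Im z) 0; last exact: nonreal_bounded_below.
  have zR : z = (complex.Re z)%:C by case: z iz {rz} => a b /= ->.
  apply: not_spectrum_bounded_below; rewrite zR => /qe.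
  move: rz; rewrite zR /root horner_map/= (fmorph_eq0 (real_complex R)).
  rewrite !hornerE -expr2 subr_eq0 -[q.[_] ^+ 2]real_normK ?num_real//.
  rewrite eqrXn2 ?(ltW N0)// => /eqP->.
  by rewrite leNgt eN.
rewrite -poly_opE in hd.
have hP v : poly_op P T v = Q (Q v) - (N ^+ 2)%:C *: v.
  by rewrite /P poly_opB poly_opC (poly_opM _ _ _ (proj1 sT)).
have key v : d ^+ 2 * nrm v ^+ 2 <= N ^+ 2 * (N ^+ 2 * nrm v ^+ 2 - nrm (Q v) ^+ 2).
  have h1 : (d * nrm v) ^+ 2 <= nrm (poly_op P T v) ^+ 2.
    by rewrite ler_pXn2r// ?nnegrE ?mulr_ge0 ?nrm_ge0 ?(ltW d0).
  have h2 : nrm (Q (Q v)) ^+ 2 <= (N * nrm (Q v)) ^+ 2.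
    by rewrite ler_pXn2r// ?nnegrE ?mulr_ge0 ?nrm_ge0 ?(ltW N0).
  have h3 : nrm (poly_op P T v) ^+ 2 =
     nrm (Q (Q v)) ^+ 2 - 2 * N ^+ 2 * nrm (Q v) ^+ 2 + N ^+ 4 * nrm v ^+ 2.
    have hq : rip (Q (Q v)) v = nrm (Q v) ^+ 2 by rewrite aQ sqr_nrm.
    by rewrite hP sqr_nrm !ripE (ripC v (Q (Q v))) hq -!sqr_nrm; ring.
  by nra.
have N4 : d ^+ 2 <= N ^+ 4.
  rewrite -(@ler_pM2r _ (nrm v0 ^+ 2)) ?exprn_gt0//; have := key v0.
  by have := mulr_ge0 (sqr_ge0 N) (sqr_ge0 (nrm (Q v0))); nra.
(* By [key], [t < N] still bounds [Q] on the unit ball. *)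
set t := Num.sqrt (N ^+ 4 - d ^+ 2) / N.
have tN : N <= t.
  apply: ge_sup; first exact: (proj1 supS).
  move=> _ [v /= v1 <-]; rewrite ler_pdivlMr//.
  rewrite -(@ler_pXn2r _ 2)// ?nnegrE ?mulr_ge0 ?sqrtr_ge0 ?nrm_ge0 ?(ltW N0)//.
  rewrite sqr_sqrtr ?subr_ge0//.
  have v1' : nrm v ^+ 2 <= 1 by rewrite -(expr1n _ 2) ler_pXn2r ?nnegrE ?nrm_ge0.
  have := key v; have : 0 <= N ^+ 4 - d ^+ 2 by rewrite subr_ge0.
  by nra.
move: tN; rewrite ler_pdivlMr// -(@ler_pXn2r _ 2)// ?nnegrE ?mulr_ge0 ?sqrtr_ge0 ?(ltW N0)//.
rewrite sqr_sqrtr ?subr_ge0//; have : 0 < d ^+ 2 by rewrite exprn_gt0.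
by nra.
Qed.

(** A constant [q] needs a point in the spectrum.  If the real spectrum is
    empty, then the bound for ['X] and ['X + 1], with [e = 0], shows that the
    whole space is [0]. *)
Lemma spectral_bound (q : {poly R}) T (e : R) : selfadj T ->
  (forall x : R, spectrum T x%:C -> `|q.[x]| <= e) -> 0 <= e ->
  forall v, nrm (poly_op q T v) <= e * nrm v.
Proof.
move=> sT qe e0 v; have [q1|q1] := ltnP 1 (size q).
  exact: spectral_bound_size.
rewrite (size1_polyC q1) in qe *; set c := q`_0 in qe *.
rewrite poly_opC nrmZr.
have [[x hx]|hn] := pselect (exists x : R, spectrum T x%:C).
  by have := qe x hx; rewrite hornerC => h; rewrite ler_wpM2r ?nrm_ge0.
have zero (p : {poly R}) : (1 < size p)%N -> poly_op p T v = 0.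
  move=> p1; apply: nrm_eq0; apply/eqP; rewrite eq_le nrm_ge0 andbT.
  rewrite -[leRHS](mul0r (nrm v)); apply: spectral_bound_size => // x hx.
  by case: hn; exists x.
have := zero ('X + 1%:P); rewrite size_XaddC => /(_ isT).
rewrite poly_opD poly_opC zero ?size_polyX// add0r scale1r => ->.
by rewrite nrm0 !mulr0.
Qed.

End PolyCalculus.

(** * Continuous functional calculus *)

Section FunctionalCalculus.
Variables (R : realType) (Omega : Type) (H : rkhs R Omega).
Implicit Types (v : H) (T W S : H -> H) (f g h : R -> R).

(** By [weierstrass] continuous functions have this property, which is all that
    the functional calculus uses and which is visibly stable under products. *)
Definition poly_approximable (a b : R) f := forall e : R, 0 < e ->
  exists p : {poly R}, forall x, a <= x <= b -> `|p.[x] - f x| <= e.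

Lemma poly_bounded_itv (p : {poly R}) (a b : R) :
  exists2 M, 0 <= M & forall x, a <= x <= b -> `|p.[x]| <= M.
Proof.
elim/poly_ind: p => [|p c [M M0 hM]]; first by exists 0 => // x; rewrite horner0 normr0.
exists (M * (`|a| + `|b|) + `|c|); first by rewrite addr_ge0// mulr_ge0// addr_ge0.
move=> x xab; rewrite !hornerE; apply: le_trans (ler_normD _ _) _.
rewrite lerD2r normrM ler_pM// ?hM//.
rewrite ler_norml; case/andP: xab => ax xb.
have := ler_norm b; have := ler_normr (- a) a; rewrite lerN2.
have := ler_norm (- a); rewrite normrN.
have := normr_ge0 b; have := normr_ge0 a.
by move=> *; apply/andP; split; lra.
Qed.

Lemma poly_approximable_bounded a b f : poly_approximable a b f ->
  exists2 M, 0 <= M & forall x, a <= x <= b -> `|f x| <= M.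
Proof.
move=> /(_ 1 ltr01)[p hp]; have [M M0 hM] := poly_bounded_itv p a b.
exists (M + 1) => [|x xab]; first by rewrite addr_ge0.
have -> : f x = p.[x] - (p.[x] - f x) by rewrite subKr.
by have := ler_normB p.[x] (p.[x] - f x); have := hp x xab; have := hM x xab; lra.
Qed.

Lemma poly_approximable_poly (p : {poly R}) a b f :
  (forall x, a <= x <= b -> f x = p.[x]) -> poly_approximable a b f.
Proof.
by move=> h e e0; exists p => x /h->; rewrite subrr normr0 ltW.
Qed.

(** Proves identities between limits of operators without naming a sequence. *)
Lemma small_eq0 (x : H) (K : R) : 0 <= K -> (forall e : R, 0 < e -> nrm x <= e * K) -> x = 0.
Proof.
move=> K0 h; apply: nrm_eq0; apply/eqP; rewrite eq_le nrm_ge0 andbT.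
have K1 : 0 < K + 1 by lra.
apply/ler_addgt0Pr => e e0; rewrite add0r.
apply: le_trans (h (e / (K + 1)) (divr_gt0 e0 K1)) _.
by rewrite -mulrA ler_piMr ?(ltW e0)// mulrC ler_pdivrMr// mul1r; lra.
Qed.

Lemma poly_op_bound_itv (q : {poly R}) T (a b e : R) : a <= b ->
  selfadj T -> form_between a b T ->
  (forall x, a <= x <= b -> `|q.[x]| <= e) ->
  forall v, nrm (poly_op q T v) <= e * nrm v.
Proof.
move=> ab sT Tab hq; apply: spectral_bound => //.
  by move=> x /(spectrum_itv sT Tab)/hq.
by apply: le_trans (hq a _); rewrite ?lexx.
Qed.

(** The operators [p_n(T)] are uniformly Cauchy when [p_n] tends to [f]
    uniformly, by [poly_op_bound_itv]. *)
Lemma cfc_exists T (a b : R) f : a <= b -> selfadj T -> form_between a b T ->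
  poly_approximable a b f ->
  exists S, bounded_operator S /\ forall e : R, 0 < e -> exists p : {poly R},
    (forall x, a <= x <= b -> `|p.[x] - f x| <= e) /\
    (forall v, nrm (poly_op p T v - S v) <= e * nrm v).
Proof.
move=> ab sT Tab fa; have bT := proj1 sT.
have /choice[p hp] (n : nat) : exists p : {poly R},
    forall x, a <= x <= b -> `|p.[x] - f x| <= n.+1%:R^-1.
  by apply: fa; rewrite invr_gt0.
have pd m n v : nrm (poly_op (p m) T v - poly_op (p n) T v) <=
    (m.+1%:R^-1 + n.+1%:R^-1) * nrm v.
  rewrite -poly_opB; apply: (poly_op_bound_itv ab sT Tab) => x xab.
  rewrite !hornerE (_ : _ - _ = (p m).[x] - f x - ((p n).[x] - f x)); last by ring.
  apply: le_trans (ler_normB _ _) _.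
  by apply: lerD; apply: hp.
have /choice[S hS] v : exists l, cvgs (fun n => poly_op (p n) T v) l.
  apply: hilbert_complete => e e0.
  have v1 : 0 < 2 * (nrm v + 1) by have := nrm_ge0 v; lra.
  have [N hN] := invn_small (divr_gt0 e0 v1).
  exists N => m n /hN hm /hN hn; apply: le_trans (pd _ _ _) _.
  apply: (@le_trans _ _ ((e / (2 * (nrm v + 1)) + e / (2 * (nrm v + 1))) * nrm v)).
    by rewrite ler_wpM2r ?nrm_ge0// lerD.
  rewrite -mulrDl mulrAC ler_pdivrMr//.
  by have := nrm_ge0 v; nra.
have near n v : nrm (poly_op (p n) T v - S v) <= 2 / n.+1%:R * nrm v.
  apply/ler_addgt0Pr => e e0.
  have i0 : 0 < n.+1%:R^-1 :> R by rewrite invr_gt0.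
  have [N1 h1] := invn_small i0.
  have [N2 h2] := hS v e e0.
  set m := maxn N1 N2.
  have {}h1 := h1 m (leq_maxl _ _); have {}h2 := h2 m (leq_maxr _ _).
  have -> : poly_op (p n) T v - S v =
      (poly_op (p n) T v - poly_op (p m) T v) + (poly_op (p m) T v - S v).
    by rewrite addrA subrK.
  apply: le_trans (nrmD _ _) _; apply: lerD => //.
  apply: le_trans (pd _ _ _) _; rewrite ler_wpM2r ?nrm_ge0//.
  by move: h1; move: (m.+1%:R^-1) (n.+1%:R^-1) => ? ? ?; lra.
have bp n := poly_op_bounded (p n) bT.
exists S; split.
  have [M M0 hM] := op_bound (bp 0%N).
  apply: (@bounded_operator_intro _ _ H S (M + 2)) => [c x y|x].
    apply/eqP; rewrite -subr_eq0; apply/eqP.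
    apply: (@small_eq0 _ (2 * (nrm (c *: x + y) + cmod c * nrm x + nrm y))).
      by rewrite mulr_ge0// !addr_ge0 ?mulr_ge0 ?nrm_ge0 ?cmod_ge0.
    move=> e /invn_small[N /(_ N (leqnn N)) hN].
    set P := poly_op (p N) T.
    have -> : S (c *: x + y) - (c *: S x + S y) =
        c *: (P x - S x) + (P y - S y) - (P (c *: x + y) - S (c *: x + y)).
      rewrite /P (op_linear (bp N)) scalerBr opprB [X in _ = X + _]addrACA -opprD.
      by rewrite [RHS]addrC addrA subrK.
    apply: le_trans (nrmB _ _) _; apply: le_trans (lerD (nrmD _ _) (lexx _)) _.
    rewrite nrmZ.
    have := near N x; have := near N y; have := near N (c *: x + y); rewrite -/P.
    have : cmod c * nrm (P x - S x) <= cmod c * (2 / N.+1%:R * nrm x).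
      by rewrite ler_wpM2l ?cmod_ge0//; exact: near.
    have : 0 <= nrm (c *: x + y) + cmod c * nrm x + nrm y.
      by rewrite !addr_ge0 ?mulr_ge0 ?nrm_ge0 ?cmod_ge0.
    by move: hN; move: (N.+1%:R^-1) (nrm _) (nrm _) (nrm _) (nrm _) (nrm _) (nrm _) (cmod c) => *; nra.
  have := near 0%N x; have := hM x; rewrite invr1 mulr1 => h1 h2.
  have -> : S x = poly_op (p 0%N) T x - (poly_op (p 0%N) T x - S x) by rewrite subKr.
  by apply: le_trans (nrmB _ _) _; rewrite mulrDl lerD.
move=> e e0; have e2 : 0 < e / 2 by lra.
have [N /(_ N (leqnn N)) hN] := invn_small e2.
exists (p N); split => [x /(hp N) h|v].
  by apply: le_trans h _; move: hN; move: (N.+1%:R^-1) => *; lra.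
apply: le_trans (near N v) _; rewrite ler_wpM2r ?nrm_ge0//.
by move: hN; move: (N.+1%:R^-1) => *; lra.
Qed.

(** Two polynomials close to [f] on the spectrum are close to each other there,
    so by [spectral_bound] their values at [T] are close: the operator [cfc f T]
    is within [e] of every polynomial that is within [e] of [f], not only of
    those in its definition.  This gives uniqueness and all rules below. *)
Lemma cfcP T (a b : R) f : a <= b -> selfadj T -> form_between a b T ->
  poly_approximable a b f ->
  bounded_operator (cfc f T) /\
  forall (p : {poly R}) e, (forall x, a <= x <= b -> `|p.[x] - f x| <= e) ->
    forall v, nrm (poly_op p T v - cfc f T v) <= e * nrm v.
Proof.
move=> ab sT Tab fa.
have [bS hS] : [set S : H -> H | bounded_operator S /\
    forall e : R, 0 < e -> exists p : {poly R},
      (forall x : R, spectrum T x%:C -> `|p.[x] - f x| <= e) /\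
      (forall v : H, `|poly_op p T v - S v| <= e%:C * `|v|)] (cfc f T).
  apply: getPex; have [S [bS hS]] := cfc_exists ab sT Tab fa.
  exists S; split => // e /hS[p [hp hv]]; exists p; split => [x|v].
    by move=> /(spectrum_itv sT Tab)/hp.
  by rewrite !nrmE -rmorphM lecR.
split=> // p e hp v.
apply/ler_addgt0Pr => d d0.
have v1 : 0 < 2 * (nrm v + 1) by have := nrm_ge0 v; lra.
have := hS (d / (2 * (nrm v + 1))) (divr_gt0 d0 v1).
set e' := d / _; move=> [p' [hp' hv']].
have e'0 : 0 < e' by apply: divr_gt0.
have e0 : 0 <= e by apply: le_trans (hp a _); rewrite ?lexx.
have -> : poly_op p T v - cfc f T v =
    poly_op (p - p') T v + (poly_op p' T v - cfc f T v).
  by rewrite poly_opB addrA subrK.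
apply: le_trans (nrmD _ _) _.
have h1 : nrm (poly_op (p - p') T v) <= (e + e') * nrm v.
  apply: spectral_bound => // [x hx|]; last by rewrite addr_ge0// ltW.
  rewrite !hornerE (_ : _ - _ = p.[x] - f x - (p'.[x] - f x)); last by ring.
  apply: le_trans (ler_normB _ _) _.
  by apply: lerD; [apply: hp; exact: (spectrum_itv sT Tab) | exact: hp'].
have h2 : nrm (poly_op p' T v - cfc f T v) <= e' * nrm v.
  by have := hv' v; rewrite !nrmE -rmorphM lecR.
have h3 : e' * (2 * (nrm v + 1)) = d by rewrite divfK ?gt_eqF.
by have := nrm_ge0 v; nra.
Qed.

Section Interval.
Variables (a b : R).
Hypothesis ab : a <= b.

Lemma cfc_poly T f (p : {poly R}) : selfadj T -> form_between a b T ->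
  (forall x, a <= x <= b -> f x = p.[x]) -> cfc f T = poly_op p T.
Proof.
move=> sT Tab fp; have fa := poly_approximable_poly fp.
have [_ h] := cfcP ab sT Tab fa.
apply/funext => v; apply/esym/eqP; rewrite -subr_eq0; apply/eqP/nrm_eq0/eqP.
rewrite eq_le nrm_ge0 andbT -[leRHS](mul0r (nrm v)); apply: h => x /fp ->.
by rewrite subrr normr0.
Qed.

(** The relation passes from [T] to its polynomials; one interval containing both
    spectra allows the same polynomials for [f] on both sides. *)
Lemma cfc_intertwine T T' W f : selfadj T -> form_between a b T ->
  selfadj T' -> form_between a b T' -> poly_approximable a b f ->
  bounded_operator W -> (forall x, T (W x) = W (T' x)) ->
  forall x, cfc f T (W x) = W (cfc f T' x).
Proof.
move=> sT Tab sT' Tab' fa bW hW x.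
have [_ h] := cfcP ab sT Tab fa; have [_ h'] := cfcP ab sT' Tab' fa.
have [M M0 hM] := op_bound bW.
apply/eqP; rewrite -subr_eq0; apply/eqP.
apply: (@small_eq0 _ (nrm (W x) + M * nrm x)).
  by rewrite addr_ge0 ?mulr_ge0 ?nrm_ge0.
move=> e /fa[p hp].
have -> : cfc f T (W x) - W (cfc f T' x) =
   W (poly_op p T' x - cfc f T' x) - (poly_op p T (W x) - cfc f T (W x)).
  rewrite (poly_op_intertwine p bW hW) (opB bW) opprB [RHS]addrC addrA.
  by rewrite subrK.
apply: le_trans (nrmB _ _) _; rewrite addrC mulrDr lerD//; first exact: h.
apply: le_trans (hM _) _; rewrite mulrCA ler_wpM2l//; exact: h'.
Qed.

Lemma cfc_selfadj T f : selfadj T -> form_between a b T -> poly_approximable a b f ->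
  selfadj (cfc f T).
Proof.
move=> sT Tab fa; have [bS h] := cfcP ab sT Tab fa; split=> // x y.
apply/eqP; rewrite -subr_eq0 -normr_le0; apply/ler_addgt0Pr => e e0; rewrite add0r.
set K := nrm x * nrm y; have K0 : 0 <= K by rewrite mulr_ge0 ?nrm_ge0.
have K1 : 0 < 2 * (K + 1) by lra.
have [p hp] := fa (e / (2 * (K + 1))) (divr_gt0 e0 K1).
set d := e / _ in hp.
have hd : d * (2 * (K + 1)) = e by rewrite divfK ?gt_eqF.
have d0 : 0 < d by apply: divr_gt0.
have sp := proj2 (poly_op_selfadj p sT) x y.
have -> : rip (cfc f T x) y - rip x (cfc f T y) =
   rip x (poly_op p T y - cfc f T y) - rip (poly_op p T x - cfc f T x) y.
  by rewrite !ripE sp; ring.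
apply: le_trans (ler_normB _ _) _.
have h1 : `|rip x (poly_op p T y - cfc f T y)| <= d * K.
  apply: le_trans (rip_abs _ _) _; rewrite /K mulrCA ler_wpM2l ?nrm_ge0//; exact: h.
have h2 : `|rip (poly_op p T x - cfc f T x) y| <= d * K.
  apply: le_trans (rip_abs _ _) _; rewrite /K mulrA ler_wpM2r ?nrm_ge0//; exact: h.
by nra.
Qed.

Lemma poly_approximableM f g : poly_approximable a b f -> poly_approximable a b g ->
  poly_approximable a b (fun x => f x * g x).
Proof.
move=> fa ga e e0.
have [F F0 hF] := poly_approximable_bounded fa.
have [G G0 hG] := poly_approximable_bounded ga.
have K0 : 0 < F + G + 1 by lra.
have m0 : 0 < Num.min 1 (e / (F + G + 1)) by rewrite lt_min ltr01 divr_gt0.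
have [p hp] := fa _ m0; have [q hq] := ga _ m0; exists (p * q) => x xab.
set d := Num.min _ _ in m0 hp hq.
have dK : d * (F + G + 1) <= e by rewrite -ler_pdivlMr// ge_min lexx orbT.
rewrite hornerM; apply: le_trans (mul_dist_le _ (hF x xab) (hG x xab)
  (hp x xab) (hq x xab)) dK.
by rewrite (ltW m0) ge_min lexx.
Qed.

(** If [p] and [q] approximate [f] and [g], then [p q] approximates [f g], and
    [p(T) q(T) = (p q)(T)]. *)
Lemma cfc_mul T f g : selfadj T -> form_between a b T ->
  poly_approximable a b f -> poly_approximable a b g ->
  forall v, cfc f T (cfc g T v) = cfc (fun x => f x * g x) T v.
Proof.
move=> sT Tab fa ga v; have bT := proj1 sT.
have fga := poly_approximableM fa ga.
have [bf hf] := cfcP ab sT Tab fa; have [bg hg] := cfcP ab sT Tab ga.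
have [bfg hfg] := cfcP ab sT Tab fga.
have [F F0 hF] := poly_approximable_bounded fa.
have [G G0 hG] := poly_approximable_bounded ga.
have [Mg Mg0 hMg] := op_bound bg.
apply/eqP; rewrite -subr_eq0; apply/eqP.
apply: (@small_eq0 _ ((F + 1 + Mg + (F + G + 1)) * nrm v)).
  by rewrite mulr_ge0 ?nrm_ge0// !addr_ge0.
move=> e e0.
have m0 : 0 < Num.min 1 e by rewrite lt_min ltr01.
have [p hp] := fa _ m0; have [q hq] := ga _ m0.
set d := Num.min _ _ in m0 hp hq.
have d1 : d <= 1 by rewrite ge_min lexx.
have de : d <= e by rewrite ge_min lexx orbT.
have hpq x : a <= x <= b -> `|(p * q).[x] - f x * g x| <= d * (F + G + 1).
  move=> xab; rewrite hornerM; apply: mul_dist_le (hF x xab) (hG x xab)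
    (hp x xab) (hq x xab).
  by rewrite (ltW m0).
have H1 := hfg _ _ hpq v; rewrite (poly_opM _ _ _ bT) in H1.
have H2 : nrm (poly_op p T (poly_op q T v - cfc g T v)) <= (F + 1) * (d * nrm v).
  apply: le_trans (_ : (F + 1) * nrm (poly_op q T v - cfc g T v) <= _).
    apply: (poly_op_bound_itv ab sT Tab) => x xab.
    have -> : p.[x] = f x + (p.[x] - f x) by ring.
    by have := ler_normD (f x) (p.[x] - f x); have := hF x xab; have := hp x xab; lra.
  by rewrite ler_wpM2l ?addr_ge0// hg.
have H3 : nrm (poly_op p T (cfc g T v) - cfc f T (cfc g T v)) <= d * (Mg * nrm v).
  by apply: le_trans (hf _ _ hp _) _; rewrite ler_wpM2l ?(ltW m0).
have -> : cfc f T (cfc g T v) - cfc (fun x => f x * g x) T v =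
   (poly_op p T (poly_op q T v) - cfc (fun x => f x * g x) T v)
   - (poly_op p T (poly_op q T v - cfc g T v)
      + (poly_op p T (cfc g T v) - cfc f T (cfc g T v))).
  rewrite (opB (poly_op_bounded p bT)) [X in _ = _ - X]addrA subrK opprB.
  by rewrite [RHS]addrC addrA subrK.
apply: le_trans (nrmB _ _) _; apply: le_trans (lerD (lexx _) (nrmD _ _)) _.
have vd : d * nrm v <= e * nrm v by rewrite ler_wpM2r ?nrm_ge0.
have : d * ((F + 1 + Mg + (F + G + 1)) * nrm v) <= e * ((F + 1 + Mg + (F + G + 1)) * nrm v).
  by rewrite ler_wpM2r// mulr_ge0 ?nrm_ge0// !addr_ge0.
by nra.
Qed.

(** Subtract the midpoint [c] of an interval containing the values of [u]: the
    norm of [u(T) - c] is at most half the length of that interval. *)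
Lemma poly_op_form_ge (u : {poly R}) T (e : R) : selfadj T -> form_between a b T ->
  (forall x, a <= x <= b -> e <= u.[x]) ->
  forall v, e * nrm v ^+ 2 <= rip (poly_op u T v) v.
Proof.
move=> sT Tab ue v; have [M M0 hM] := poly_bounded_itv u a b.
set c := (M + e) / 2.
have : nrm (poly_op (u - c%:P) T v) <= (M - e) / 2 * nrm v.
  apply: (poly_op_bound_itv ab sT Tab) => x xab; rewrite !hornerE.
  have := ue x xab; have := hM x xab; rewrite !ler_norml /c => /andP[h1 h2] h3.
  by apply/andP; split; lra.
have := rip_CSn (poly_op (u - c%:P) T v) v.
rewrite poly_opB poly_opC !ripE -sqr_nrm => h1 h2.
have := nrm_ge0 v; have := nrm_ge0 (poly_op u T v - c%:C *: v).
by rewrite /c in h1 h2 *; nra.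
Qed.

(** Order is preserved: approximate [h] by [p] and use [poly_op_form_ge] for
    [p - P]. *)
Lemma cfc_form_ge (P : {poly R}) T h : selfadj T -> form_between a b T ->
  poly_approximable a b h -> (forall x, a <= x <= b -> P.[x] <= h x) ->
  forall v, rip (poly_op P T v) v <= rip (cfc h T v) v.
Proof.
move=> sT Tab ha Ph v; have [_ hh] := cfcP ab sT Tab ha.
apply/ler_addgt0Pr => e e0.
set K := nrm v ^+ 2; have K0 : 0 <= K by rewrite sqr_ge0.
have K1 : 0 < 2 * (K + 1) by lra.
have [p hp] := ha (e / (2 * (K + 1))) (divr_gt0 e0 K1).
set d := e / _ in hp.
have hd : d * (2 * (K + 1)) = e by rewrite divfK ?gt_eqF.
have d0 : 0 < d by apply: divr_gt0.
have h1 : - d * K <= rip (poly_op (p - P) T v) v.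
  apply: poly_op_form_ge => // x xab; rewrite !hornerE.
  by have := hp x xab; have := Ph x xab; rewrite ler_norml => h1 /andP[]; lra.
have h2 : `|rip (poly_op p T v - cfc h T v) v| <= d * K.
  by apply: le_trans (rip_abs _ _) _; rewrite /K expr2 mulrA ler_wpM2r ?nrm_ge0// hh.
rewrite ler_norml !ripE in h2; rewrite poly_opB !ripE in h1.
by case/andP: h2 => h2 h3; nra.
Qed.

End Interval.

Definition positive_op T := selfadj T /\ forall v, 0 <= rip (T v) v.

Lemma positive_between T : positive_op T ->
  exists2 b : R, 0 < b & forall c, b <= c -> form_between 0 c T.
Proof.
move=> [[bT sT] pT]; have [M M0 hM] := op_bound bT.
exists (M + 1) => [|c Mc v]; first by lra.
rewrite mul0r pT/=; apply: le_trans (rip_CS _ _) _.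
rewrite expr2 mulrA ler_wpM2r ?nrm_ge0//; apply: le_trans (hM v) _.
by rewrite ler_wpM2r ?nrm_ge0//; lra.
Qed.

Lemma cfc_positive T f : positive_op T -> (forall b, 0 < b -> poly_approximable 0 b f) ->
  (forall x, 0 <= x -> 0 <= f x) -> positive_op (cfc f T).
Proof.
move=> pT fa f0; have [b b0 hb] := positive_between pT.
have sT := proj1 pT; have Tb := hb b (lexx b).
split; first exact: (cfc_selfadj (ltW b0) sT Tb (fa b b0)).
move=> v; have := cfc_form_ge (P := 0) (ltW b0) sT Tb (fa b b0) _ v.
rewrite -polyC0 poly_opC ripZl mul0r; apply => x /andP[x0 _].
by rewrite hornerC f0.
Qed.

End FunctionalCalculus.

(** * Absolute values, polar decomposition and Berezin quantities *)

Section Continuity.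
Variable R : realType.

Lemma poly_approximable_cont (f : R -> R) : {within [set x : R | 0 <= x], continuous f} ->
  forall b, 0 < b -> poly_approximable 0 b f.
Proof.
move=> cf b b0; apply: weierstrass => //.
apply: continuous_subspaceW cf => x /=; by rewrite in_itv/= => /andP[].
Qed.

Lemma powR_continuous_ge0 (q : R) : 0 < q ->
  {within [set x : R | 0 <= x], continuous (fun x => x `^ q)}.
Proof.
move=> q0; apply/subspace_continuousP => x /= x0.
have [->|xn0] := eqVneq x 0.
  apply/cvgrPdist_lt => e e0; rewrite /from_subspace/= powR0 ?gt_eqF//.
  (* [y^q < e] as soon as [y < e^(1/q)]. *)
  apply/nbhs_ballP; exists (e `^ q^-1); first exact: powR_gt0.
  move=> y /=; rewrite /ball/= sub0r normrN => yd y0.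
  rewrite sub0r normrN ger0_norm ?powR_ge0//.
  rewrite ger0_norm// in yd.
  have -> : e = (e `^ q^-1) `^ q by rewrite -powRrM mulVf ?gt_eqF// powRr1// ltW.
  by apply: gt0_ltr_powR; rewrite ?nnegrE ?powR_ge0.
have xp : 0 < x by rewrite lt_def xn0.
apply: cvg_within_filter.
have : derivable (@powR R ^~ q) x 1 by apply: derivable_powR; rewrite in_itv/= xp.
by move/derivable1_diffP/differentiable_continuous.
Qed.

Lemma sqrt_continuous_ge0 :
  {within [set x : R | 0 <= x], continuous (@Num.sqrt R)}.
Proof. by apply: continuous_subspaceT; exact: sqrt_continuous. Qed.

End Continuity.

Section Berezin.
Variables (R : realType) (Omega : Type) (H : rkhs R Omega).
Implicit Types (u v w : H) (A B S T U : H -> H) (f g : R -> R).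

Lemma gram_positive A : bounded_operator A -> positive_op (adjoint A \o A).
Proof.
move=> bA; have [bA' hA'] := adjointP bA; split; last first.
  by move=> v /=; rewrite (adjC hA') rip_ge0.
split; first exact: bounded_comp.
exact: adj_comp (adjC hA') hA'.
Qed.

Lemma sqrt_approximable b : 0 < b -> poly_approximable 0 b (@Num.sqrt R).
Proof. exact: poly_approximable_cont (@sqrt_continuous_ge0 R) b. Qed.

Lemma abs_op_positive A : bounded_operator A -> positive_op (abs_op A).
Proof.
move=> bA; apply: cfc_positive; first exact: gram_positive.
- exact: sqrt_approximable.
- by move=> x _; exact: sqrtr_ge0.
Qed.

Lemma cfc_mul_id T f g : positive_op T ->
  (forall b, 0 < b -> poly_approximable 0 b f) ->
  (forall b, 0 < b -> poly_approximable 0 b g) ->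
  (forall x, 0 <= x -> f x * g x = x) ->
  forall v, cfc f T (cfc g T v) = T v.
Proof.
move=> pT fa ga fg v; have [b b0 /(_ b (lexx b)) Tb] := positive_between pT.
have sT := proj1 pT.
rewrite (cfc_mul (ltW b0) sT Tb (fa b b0) (ga b b0)).
rewrite (cfc_poly (ltW b0) sT Tb (p := 'X)) ?poly_opX// => x /andP[x0 _].
by rewrite fg// hornerX.
Qed.

Lemma abs_op_sq A v : bounded_operator A -> abs_op A (abs_op A v) = adjoint A (A v).
Proof.
move=> bA; apply: (cfc_mul_id (gram_positive bA) sqrt_approximable sqrt_approximable).
by move=> x x0; rewrite -expr2 sqr_sqrtr.
Qed.

Lemma nrm_abs_op A v : bounded_operator A -> nrm (abs_op A v) = nrm (A v).
Proof.
move=> bA; have [[_ sA] _] := abs_op_positive bA; have [_ hA] := adjointP bA.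
apply/eqP; rewrite -(@eqrXn2 _ 2)// ?nrm_ge0//; apply/eqP.
by rewrite !sqr_nrm sA abs_op_sq// hA.
Qed.

(** A polar decomposition needs this twice: for the square root, and then for
    [f] of the absolute values. *)
Lemma positive_intertwine T T' W f : positive_op T -> positive_op T' ->
  (forall b, 0 < b -> poly_approximable 0 b f) -> bounded_operator W ->
  (forall v, T (W v) = W (T' v)) -> forall v, cfc f T (W v) = W (cfc f T' v).
Proof.
move=> pT pT' fa bW h.
have [b b0 hb] := positive_between pT; have [c c0 hc] := positive_between pT'.
(* A common interval for the two operators. *)
set m := Num.max b c.
have m0 : 0 < m by rewrite lt_max b0.
apply: (cfc_intertwine (ltW m0) (proj1 pT) _ (proj1 pT') _ (fa m m0) bW h).
  by apply: hb; rewrite le_max lexx.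
by apply: hc; rewrite le_max lexx orbT.
Qed.

(** [A A* U = U A* A], because [A* = |A| U*] and [U* U |A| = |A|]; apply the
    square root. *)
Lemma abs_op_polar A U : bounded_operator A -> polar_decomposition A U ->
  forall v, abs_op (adjoint A) (U v) = U (abs_op A v).
Proof.
move=> bA [pU AU]; have bU := proj1 pU.
have [bA' hA] := adjointP bA; have [bU' hU] := adjointP bU.
have cU := partial_isometry_contraction pU; have cU' := contraction_adj hU cU.
have [[bT sT] _] := abs_op_positive bA; set T := abs_op A in AU bT sT *.
have UUT v : adjoint U (U (T v)) = T v.
  apply: contraction_isometric hU cU' _.
  by rewrite nrm_abs_op// AU.
have TUU v : T (adjoint U (U v)) = T v.
  by apply: rip_inj => z; rewrite -sT -hU -(adjC hU) UUT sT.
have A'E v : adjoint A v = T (adjoint U v).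
  by apply: rip_inj => z; rewrite -hA AU/= hU sT.
rewrite /abs_op adjointK//; apply: positive_intertwine => //.
- by have := gram_positive bA'; rewrite adjointK.
- exact: gram_positive.
- exact: sqrt_approximable.
move=> v /=; rewrite A'E TUU {1}AU/=; congr U; exact: abs_op_sq.
Qed.

(** With [y = ||S v||], the quadratic [P] of [powR_tangent] satisfies
    [<P(S) v, v> = y^q] for a unit vector [v] and lies below [x^q]. *)
Lemma mccarthy S (q : R) v : positive_op S -> 2 < q -> nrm v = 1 ->
  nrm (S v) `^ q <= rip (pow_op q S v) v.
Proof.
move=> pS q2 v1; have q0 : 0 < q by lra.
have qa := poly_approximable_cont (powR_continuous_ge0 q0).
have [y0|yn0] := eqVneq (nrm (S v)) 0.
  rewrite y0 powR0 ?gt_eqF//.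
  by have [_ h] := cfc_positive pS qa (fun x _ => powR_ge0 x q); exact: h.
set y := nrm (S v) in yn0 *.
have yp : 0 < y by rewrite lt_def yn0 nrm_ge0.
have [b b0 /(_ b (lexx b)) Sb] := positive_between pS.
have [bS sS] := proj1 pS.
pose c := q / 2 * y `^ (q - 2).
pose P : {poly R} := c *: ('X * 'X) + (y `^ q - c * y ^+ 2)%:P.
have := cfc_form_ge (P := P) (ltW b0) (proj1 pS) Sb (qa b b0) _ v.
rewrite poly_opD poly_opC poly_opZ (poly_opM _ _ _ bS) !poly_opX !ripE.
rewrite sS -!sqr_nrm v1 -/y expr1n mulr1 => h.
have -> : y `^ q = c * y ^+ 2 + (y `^ q - c * y ^+ 2) by ring.
apply: h => x /andP[x0 _]; rewrite /P !hornerE/=.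
by have := powR_tangent q2 x0 yp; rewrite -/c; lra.
Qed.

(** Move [U] past [f(|A*|)], apply Cauchy-Schwarz, then Young's inequality to
    [||f(|A|) u||^p ||g(|B|) w||^p], then McCarthy's inequality to each term;
    [p >= 2] and [r, s > 1] make both exponents exceed [2]. *)
Lemma inner_polar_bound A B U f g (p r s : R) :
  bounded_operator A -> bounded_operator B -> polar_decomposition A U ->
  (forall x, 0 <= x -> 0 <= f x) -> (forall x, 0 <= x -> 0 <= g x) ->
  {within [set x : R | 0 <= x], continuous f} ->
  {within [set x : R | 0 <= x], continuous g} ->
  1 < r -> 1 < s -> r^-1 + s^-1 = 1 -> 2 <= p ->
  forall u w, nrm u = 1 -> nrm w = 1 ->
  cmod (inner H (cfc g (abs_op B) (cfc f (abs_op (adjoint A)) (U u))) w) `^ p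
  <= r^-1 * rip (pow_op (p * r) (cfc f (abs_op A)) u) u
     + s^-1 * rip (pow_op (p * s) (cfc g (abs_op B)) w) w.
Proof.
move=> bA bB polU f0 g0 cf cg r1 s1 rs p2 u w u1 w1.
have bU := proj1 (proj1 polU).
have fa := poly_approximable_cont cf; have ga := poly_approximable_cont cg.
have pfA := cfc_positive (abs_op_positive bA) fa f0.
have pgB := cfc_positive (abs_op_positive bB) ga g0.
have fU : cfc f (abs_op (adjoint A)) (U u) = U (cfc f (abs_op A) u).
  apply: positive_intertwine => //; last exact: abs_op_polar.
    exact: abs_op_positive (proj1 (adjointP bA)).
  exact: abs_op_positive.
have [bg sg] := proj1 pgB.
set a := nrm (cfc f (abs_op A) u); set b := nrm (cfc g (abs_op B) w).
have r0 : 0 < r by lra.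
have s0 : 0 < s by lra.
have h1 : cmod (inner H (cfc g (abs_op B) (cfc f (abs_op (adjoint A)) (U u))) w)
    <= a * b.
  rewrite fU (adj_inner bg sg); apply: le_trans (inner_CS _ _) _.
  by rewrite ler_wpM2r ?nrm_ge0// (partial_isometry_contraction (proj1 polU)).
apply: (@le_trans _ _ ((a * b) `^ p)).
  by apply: ge0_ler_powR; rewrite ?nnegrE ?cmod_ge0 ?mulr_ge0 ?nrm_ge0//; lra.
rewrite powRM ?nrm_ge0//.
apply: le_trans (conjugate_powR (powR_ge0 _ _) (powR_ge0 _ _) r0 s0 rs) _.
rewrite -!powRrM [_ / r]mulrC [_ / s]mulrC.
apply: lerD; rewrite ler_wpM2l ?invr_ge0 ?(ltW r0) ?(ltW s0)//;
  apply: mccarthy => //; nra.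
Qed.

Hypothesis hkernel : forall w : Omega, rkernel H w != 0.

Lemma nrm_nkernel (w : Omega) : nrm (nkernel H w) = 1.
Proof.
have k0 := hkernel w; have n0 : `|rkernel H w| != 0 by rewrite normr_eq0.
by rewrite /nrm /nkernel normrZ normrV ?unitfE// normr_id mulVf.
Qed.

Lemma Re_le_cmod (z : R[i]) : complex.Re z <= cmod z.
Proof.
case: z => a b; rewrite /cmod/=; apply: le_trans (ler_norm a) _.
by rewrite -sqrtr_sqr ler_wsqrtr// lerDl sqr_ge0.
Qed.

Lemma le_ber A (x : Omega) : bounded_operator A ->
  rip (A (nkernel H x)) (nkernel H x) <= ber A.
Proof.
move=> bA; have [M M0 hM] := op_bound bA.
apply: le_trans (Re_le_cmod _) _; apply: ub_le_sup; last by exists x.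
exists M => _ [y _ <-]; apply: le_trans (inner_CS _ _) _.
by rewrite nrm_nkernel mulr1; apply: le_trans (hM _) _; rewrite nrm_nkernel mulr1.
Qed.

(** Every member of the set is at most [C^(1/p)]; the supremum is nonnegative
    because the set contains a nonnegative number, so it may be raised to the
    power [p]. *)
Lemma ber_norm_bound (m : R -> R -> R) (p C : R) A : inhabited Omega -> 0 < p ->
  (forall a b, 0 <= a -> 0 <= b -> 0 <= m a b) ->
  (forall x y : Omega, m (cmod (inner H (A (nkernel H x)) (nkernel H y)) `^ p)
      (cmod (inner H (adjoint A (nkernel H x)) (nkernel H y)) `^ p) <= C) ->
  ber_norm m p A `^ p <= C.
Proof.
move=> [x0] p0 m0 hC.
have C0 : 0 <= C by apply: le_trans (hC x0 x0); apply: m0; exact: powR_ge0.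
have -> : C = (C `^ p^-1) `^ p by rewrite -powRrM mulVf ?gt_eqF// powRr1.
rewrite /ber_norm; set S := (X in sup X).
have ubS : ubound S (C `^ p^-1).
  move=> _ [[x y] _ <-] /=; apply: ge0_ler_powR; rewrite ?nnegrE ?invr_ge0 ?(ltW p0)//.
  by apply: m0; exact: powR_ge0.
have [z Sz] : S !=set0.
  by eexists; exists (x0, x0).
apply: ge0_ler_powR; rewrite ?nnegrE ?powR_ge0 ?(ltW p0)//.
- apply: (@le_trans _ _ z); first by case: Sz => ? _ <-; exact: powR_ge0.
  by apply: ub_le_sup => //; exists (C `^ p^-1).
- by apply: ge_sup => //; exists z.
Qed.

Lemma cmod_conj (z : R[i]) : cmod (conjc z) = cmod z.
Proof. by case: z => a b; rewrite /cmod/= sqrrN. Qed.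

(** The entry of the adjoint at [(x, y)] is, up to conjugation, the entry of [X]
    at [(y, x)]; regrouping the weighted sum of the two bounds according to the
    point of evaluation gives one form at each point. *)
Lemma ber_norm_young (m : R -> R -> R) (p r s t : R) X F G : inhabited Omega -> 0 < p ->
  0 <= t <= 1 ->
  (forall a b, 0 <= a -> 0 <= b -> 0 <= m a b) ->
  (forall a b, 0 <= a -> 0 <= b -> m a b <= t * a + (1 - t) * b) ->
  bounded_operator X -> bounded_operator F -> bounded_operator G ->
  (forall u w, nrm u = 1 -> nrm w = 1 ->
    cmod (inner H (X u) w) `^ p <= r^-1 * rip (F u) u + s^-1 * rip (G w) w) ->
  ber_norm m p X `^ p
    <= ber ((t / r)%:C *: F + ((1 - t) / s)%:C *: G)
       + ber ((t / s)%:C *: G + ((1 - t) / r)%:C *: F).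
Proof.
move=> hO p0 /andP[t0 t1] m0 mt bX bF bG hX; apply: ber_norm_bound => // x y.
have [_ aX] := adjointP bX; have k1 := nrm_nkernel.
set u := nkernel H x; set w := nkernel H y.
have hb : cmod (inner H (adjoint X u) w) = cmod (inner H (X w) u).
  by rewrite (adj_inner bX aX) inner_conj cmod_conj.
apply: le_trans (mt _ _ (powR_ge0 _ _) (powR_ge0 _ _)) _; rewrite hb.
have h1 := hX u w (k1 x) (k1 y); have h2 := hX w u (k1 y) (k1 x).
have b1 := le_ber x (bounded_lin (t / r)%:C ((1 - t) / s)%:C bF bG).
have b2 := le_ber y (bounded_lin (t / s)%:C ((1 - t) / r)%:C bG bF).
apply: le_trans (lerD b1 b2); rewrite -/u -/w !ripE.
have h3 := ler_wpM2l t0 h1.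
have t1' : 0 <= 1 - t by lra.
have h4 := ler_wpM2l t1' h2.
by apply: le_trans (lerD h3 h4) _; rewrite le_eqVlt; apply/orP; left; apply/eqP; ring.
Qed.

End Berezin.

Theorem theorem3p10 (R : realType) (Omega : Type) (hOmega : inhabited Omega)
  (H : rkhs R Omega) (hkernel : forall w : Omega, rkernel H w != 0)
  (sigma : R -> R -> R) (sigma_ : R -> R -> R -> R)
  (hsigma : symmetric_mean sigma) (hpath : interpolation_path sigma sigma_)
  (A B U : H -> H) (hA : bounded_operator A) (hB : bounded_operator B)
  (hU : polar_decomposition A U)
  (f g : R -> R)
  (hf0 : forall x : R, 0 <= x -> 0 <= f x)
  (hg0 : forall x : R, 0 <= x -> 0 <= g x)
  (hf : {within [set x : R | 0 <= x], continuous f})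
  (hg : {within [set x : R | 0 <= x], continuous g})
  (r s : R) (hr : 1 < r) (hs : 1 < s) (hrs : r^-1 + s^-1 = 1)
  (t : R) (ht : 0 <= t <= 1)
  (hnabla : forall a b : R, 0 <= a -> 0 <= b ->
    sigma_ t a b <= t * a + (1 - t) * b)
  (p : R) (hp : 2 <= p) :
  let F := pow_op (p * r) (cfc f (abs_op A)) in
  let G T := pow_op (p * s) (cfc g (abs_op T)) in
  ber_norm (sigma_ t) p
      (cfc g (abs_op B) \o cfc f (abs_op (adjoint A)) \o U) `^ p
    <= ber ((t / r)%:C *: F + ((1 - t) / s)%:C *: G B)
       + ber ((t / s)%:C *: G B + ((1 - t) / r)%:C *: F)
  /\
  ((forall x : R, 0 <= x -> f x * g x = x) ->
   ber_norm (sigma_ t) p A `^ p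
    <= ber ((t / r)%:C *: F + ((1 - t) / s)%:C *: G (adjoint A))
       + ber ((t / s)%:C *: G (adjoint A) + ((1 - t) / r)%:C *: F)).
Proof.
have fa := poly_approximable_cont hf; have ga := poly_approximable_cont hg.
have bA' := proj1 (adjointP hA).
have p0 : 0 < p by lra.
have pow_bounded (q : R) (S : H -> H) : 0 < q -> positive_op S ->
    bounded_operator (pow_op q S).
  move=> q0 pS; have := cfc_positive pS
    (poly_approximable_cont (powR_continuous_ge0 q0)) (fun x _ => powR_ge0 x q).
  by case=> [[]].
have pfA (C : H -> H) (bC : bounded_operator C) :=
  cfc_positive (abs_op_positive bC) fa hf0.
have pgB (C : H -> H) (bC : bounded_operator C) :=
  cfc_positive (abs_op_positive bC) ga hg0.
have main (C : H -> H) : bounded_operator C ->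
  ber_norm (sigma_ t) p
      (cfc g (abs_op C) \o cfc f (abs_op (adjoint A)) \o U) `^ p
    <= ber ((t / r)%:C *: pow_op (p * r) (cfc f (abs_op A))
            + ((1 - t) / s)%:C *: pow_op (p * s) (cfc g (abs_op C)))
       + ber ((t / s)%:C *: pow_op (p * s) (cfc g (abs_op C))
            + ((1 - t) / r)%:C *: pow_op (p * r) (cfc f (abs_op A))).
  move=> bC; apply: ber_norm_young => //.
  - exact: mean_ge0 (path_mean hpath ht).
  - apply: bounded_comp; last exact: (proj1 (proj1 hU)).
    apply: bounded_comp; first exact: (proj1 (proj1 (pgB C bC))).
    exact: (proj1 (proj1 (pfA _ bA'))).
  - by apply: pow_bounded; [rewrite mulr_gt0//; lra | exact: pfA].
  - by apply: pow_bounded; [rewrite mulr_gt0//; lra | exact: pgB].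
  - by move=> u w u1 w1; apply: inner_polar_bound.
move=> F G; split; first exact: main.
move=> fg.
have AE : A = cfc g (abs_op (adjoint A)) \o cfc f (abs_op (adjoint A)) \o U.
  apply/funext => v /=.
  rewrite (cfc_mul_id (abs_op_positive bA') ga fa) => [|x x0]; last by rewrite mulrC fg.
  by rewrite (abs_op_polar hA hU) {1}(proj2 hU).
by rewrite {1}AE; exact: main.
Qed.
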